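(* The following three assertions hold. (i) If there exists a constant $c>0$ such that $E(N)\sim c\,N^2(\log N)^2$ as $N\to\infty$, then $$\int_0^1 |S(\alpha)|\,d\alpha \gg N^{1/2}(\log N)^{1/2}\quad\text{as } N\to\infty.$$ (ii) If there exists a constant $c$ with $0<c<1/\sqrt2$ such that $\int_0^1|S(\alpha)|\,d\alpha\sim c\,N^{1/2}(\log N)^{1/2}$ as $N\to\infty$, then $$E(N)\gg N^2(\log N)^2.$$ (iii) If $E(N)=o(N^2(\log N)^2)$ as $N\to\infty$, then $$\int_0^1|S(\alpha)|\,d\alpha\sim \frac{1}{\sqrt2}N^{1/2}(\log N)^{1/2}\quad\text{as }N\to\infty.$$
   Context: $N$ denotes a positive integer, $e(u)=e^{2\pi i u}$, and $\Lambda$ is the von Mangoldt function. Set $S(\alpha)=\sum_{n\le N}\Lambda(n)e(n\alpha)$ (which depends on $N$) and, for an integer $k$, $\psi_2(N,k)=\sum_{1\le n,n'\le N,\ n'-n=k}\Lambda(n)\Lambda(n')$. For nonzero integers $k$, the singular series is $\mathfrak S(k)=2C_2\prod_{p\mid k,\ p>2}\frac{p-1}{p-2}$ if $k$ is even, and $\mathfrak S(k)=0$ if $k$ is odd, where $C_2=\prod_{p>2}\left(1-\frac{1}{(p-1)^2}\right)$ and $p$ runs over primes. Define $$E(N)=\sum_{1\le|k|\le N}\bigl(\psi_2(N,k)-\mathfrak S(k)(N-|k|)\bigr)^2.$$ The notation $f(N)\gg g(N)$ means that there is a constant $c'>0$ with $f(N)\ge c' g(N)$ for all sufficiently large $N$.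 *)

(* Defs.v *)
From HB Require Import structures.
From mathcomp Require Import all_boot all_order all_algebra.
From mathcomp Require Import all_classical all_reals all_analysis.
From mathcomp Require Import complex.
Set Implicit Arguments.
Unset Strict Implicit.
Unset Printing Implicit Defensive.
Import Order.TTheory GRing.Theory Num.Theory.
Import numFieldNormedType.Exports.

Local Open Scope classical_set_scope.
Local Open Scope ring_scope.
Local Open Scope complex_scope.

(* [primes n] lists the distinct prime divisors of n > 0 ([primes 0] is empty),
   so the first branch is the case n = p ^ m with p prime and m >= 1. *)
Definition von_mangoldt (R : realType) (n : nat) : R :=
  if primes n is [:: p] then ln p%:R else 0.

Definition e (R : realType) (u : R) : R[i] :=
  cos (2 * pi * u) +i* sin (2 * pi * u).

Definition mangoldt_expsum (R : realType) (N : nat) (alpha : R) : R[i] :=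
  \sum_(1 <= n < N.+1) (von_mangoldt R n)%:C * e (n%:R * alpha).

Definition L1_norm (R : realType) (N : nat) : R :=
  \int[lebesgue_measure]_(alpha in `[0, 1]) Normc.normc (mangoldt_expsum N alpha).

Definition psi2 (R : realType) (N : nat) (k : int) : R :=
  \sum_(1 <= n < N.+1) \sum_(1 <= n' < N.+1 | n'%:Z - n%:Z == k)
    von_mangoldt R n * von_mangoldt R n'.

Definition C2 (R : realType) : R :=
  limn (fun n => \prod_(3 <= p < n | prime p) (1 - ((p%:R - 1) ^+ 2)^-1) : R).

(* Meaningful only for k != 0. *)
Definition singular_series (R : realType) (k : int) : R :=
  if (2 %| k)%Z then
    2 * C2 R * \prod_(p <- primes `|k|%N | (2 < p)%N) ((p%:R - 1) / (p%:R - 2))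
  else 0.

(* The sum over 1 <= |k| <= N is grouped into the pairs {k, -k}, k > 0. *)
Definition E (R : realType) (N : nat) : R :=
  let error (k : int) :=
    (psi2 R N k - singular_series R k * (N%:R - `|k|%N%:R)) ^+ 2 in
  \sum_(1 <= k < N.+1) (error k%:Z + error (- k%:Z)).

Definition vinogradov_gg (R : realType) (f g : nat -> R) : Prop :=
  exists2 c : R, 0 < c & \forall N \near \oo, c * g N <= f N.

(* Main.v *)
Require Import Defs.
From mathcomp Require Import all_boot all_order all_algebra.
From mathcomp Require Import all_classical all_reals all_analysis.
From mathcomp Require Import complex ring lra zify.
Import Order.TTheory GRing.Theory Num.Theory.
Import numFieldNormedType.Exports.
Local Open Scope classical_set_scope.
Local Open Scope ring_scope.
Set Implicit Arguments.
Unset Strict Implicit.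
Unset Printing Implicit Defensive.

(** The Fourier coefficients of |S|^2 are the correlations psi_2(N, k), so a bound on
    E(N) says that |S|^2 is close in L^2 to the cosine polynomial with coefficients
    SS(k) (N - |k|) and constant term V = \sum_(n <= N) Lambda(n)^2.  Expand
    SS(k) = 2 C_2 \sum_(2d | k) h(d), where h is multiplicative, supported on odd
    squarefree numbers, with h(p) = 1/(p-2), and cut the sum at D = sqrt N.  The terms
    d > D are negligible in L^2.  The terms d <= D give
      |S|^2 = y + P + W,   y = V - 2 C_2 N \sum_(d <= D) h(d),
    where P >= 0 is a combination of Fejer-type kernels peaking at the fractions with
    denominator 2d and the mean square of W is O(E(N)) + o((N log N)^2).  At frequency
    zero a bound on E(N) yields the prime number theorem, hence V ~ N log N, and
    2 C_2 \sum_(d <= D) h(d) ~ log D = (log N)/2, so that y ~ (N log N)/2.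

    For the lower bound positivity of P is enough: integrate
      sqrt(L) |S| >= min(|S|^2, L) >= y + W - W^2 / (4 (L - y)).
    For the upper bound, P has integral o(N log N) outside a set of small measure
    around the fractions, and on that set Cauchy-Schwarz applies.  Both facts follow from
    comparison with sums of Fejer kernels, so only the integrals of trigonometric
    polynomials are ever computed. *)

(** * Multiplicative weights *)

(** The cut at sqrt N is forced from two sides. If all d <= N were kept, y would be o(N log N) and
    positivity of P would say nothing. The mean square of the discarded terms is bounded by a
    constant times (N^3 / D^2) log N, so D may not be much smaller than sqrt N. For the upper bound,
    let 1/L be the scale of nearness to the fractions: the exceptional set has measure O(D/L) and P
    integrates off it to O(L D). With L = m D, m a large constant, these are O(1/m) and O(m N), so D
    may not be much larger than sqrt N. The constant 1/sqrt 2 reflects log D = (log N)/2.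

    The eventual estimates carry the bound on E as a hypothesis about the single N at hand. This
    lets assertion (ii), argued by contradiction at one N, give a lower bound for E(N) at every
    large N. *)

Section MultiplicativeWeights.
Context {R : realType}.
Implicit Types (p q d n m z X M : nat) (F w : nat -> R).

Lemma sum_multiples p X F : (0 < p)%N ->
  \sum_(1 <= n < X.+1 | (p %| n)%N) F n =
  \sum_(1 <= m < (X %/ p).+1) F (p * m)%N.
Proof.
move=> p0; elim: X => [|X IH]; first by rewrite div0n !big_geq.
rewrite big_mkcond big_nat_recr //= -big_mkcond IH divnS //.
case: ifP => pX; last by rewrite addr0 add0n.
rewrite add1n [RHS]big_nat_recr //= (_ : (p * (X %/ p).+1)%N = X.+1) //.
by move: (divnS X p0); rewrite pX add1n => <-; rewrite mulnC divnK.
Qed.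

(* For [z > n] these are the values at [n] of two multiplicative functions:
   [afac] is supported on odd squarefree numbers (the factor at 2 vanishes because
   of division by zero) with value p/(p-2) at p, and [sfac] has value 1 + 6/p at
   every power of p. *)
Definition afac z n : R :=
  \prod_(0 <= p < z | prime p && (p %| n)%N)
    (if (p ^ 2 %| n)%N then 0 else p%:R / (p%:R - 2)).

Definition sfac z n : R :=
  \prod_(0 <= p < z | prime p && (p %| n)%N) (1 + 6 / p%:R).

Lemma prime_ge3 p : prime p -> p != 2%N -> (3 <= p)%N.
Proof. by move=> pp p2; rewrite ltn_neqAle eq_sym p2 prime_gt1. Qed.

Lemma local_factor_ge0 p : prime p -> 0 <= (p%:R / (p%:R - 2) : R).
Proof.
move=> pp; apply: divr_ge0 => //.
by rewrite subr_ge0 ler_nat prime_gt1.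
Qed.

(** Equality at [p = 3] fixes the constant 6; at [p = 2] the left side is 2/0 = 0. *)
Lemma local_factor_le p : prime p -> p%:R / (p%:R - 2) <= 1 + 6 / p%:R :> R.
Proof.
move=> pp; have [->|p2] := eqVneq p 2%N.
  by rewrite subrr invr0 mulr0; lra.
have p3 : 3 <= p%:R :> R by rewrite ler_nat prime_ge3.
rewrite ler_pdivrMr; last by lra.
rewrite mulrDl mul1r -mulrA [X in _ + X]mulrC -mulrA -subr_ge0.
have -> : p%:R - 2 + (p%:R)^-1 * ((p%:R - 2) * 6) - p%:R = (4 * p%:R - 12) / p%:R :> R.
  by field; apply/eqP => h; move: p3; rewrite h; lra.
by apply: divr_ge0; lra.
Qed.

Lemma afac_ge0 z n : 0 <= afac z n.
Proof.
apply: prodr_ge0 => p /andP[pp _]; case: ifP => // _.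
exact: local_factor_ge0.
Qed.

Lemma sfac_factor_ge1 p : 1 <= 1 + 6 / p%:R :> R.
Proof. by rewrite lerDl divr_ge0. Qed.

Lemma sfac_ge0 z n : 0 <= sfac z n.
Proof. by apply: prodr_ge0 => p _; rewrite (le_trans ler01) // sfac_factor_ge1. Qed.

Lemma sfac_ge1 z n : 1 <= sfac z n.
Proof.
rewrite /sfac; elim/big_ind: _ => // [x y hx hy|p _]; last exact: sfac_factor_ge1.
by rewrite -[1]mulr1 ler_pM.
Qed.

Lemma afac_le_sfac z n : afac z n <= sfac z n.
Proof.
apply: ler_prod => p /andP[pp _]; case: ifP => _; first by rewrite lexx /= addr_ge0 ?divr_ge0.
by rewrite local_factor_ge0 // local_factor_le.
Qed.

Lemma sfacM z n m : sfac z (n * m) <= sfac z n * sfac z m.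
Proof.
rewrite /sfac !(big_mkcond (fun p => _ && _)) -big_split /=.
apply: ler_prod => p _; case: (boolP (prime p)) => //= pp; last by rewrite mulr1 ler01 lexx.
rewrite Euclid_dvdM //; have h := sfac_factor_ge1 p.
by do 2![case: (p %| _)%N => /=]; rewrite ?mulr1 ?mul1r ?lexx ?ler01 ?andbT; nra.
Qed.

Lemma dvdn_mul_prime p q n : prime p -> prime q -> p != q -> (p %| q * n)%N = (p %| n)%N.
Proof. by move=> pp pq pq'; rewrite Gauss_dvdr // prime_coprime // dvdn_prime2. Qed.

Lemma dvdn2_mul_prime p q n : prime p -> prime q -> p != q ->
  (p ^ 2 %| q * n)%N = (p ^ 2 %| n)%N.
Proof.
move=> pp pq pq'; rewrite Gauss_dvdr // coprime_pexpl //.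
by rewrite prime_coprime // dvdn_prime2.
Qed.

(** Only primes below the cutoff [p] are seen, so a factor [p] goes unnoticed. Sums over multiples
    of [p] therefore rescale into sums of the same kind. *)
Lemma afac_prime_mul p m : prime p -> afac p (p * m) = afac p m.
Proof.
move=> pp; rewrite /afac big_nat_cond [in RHS]big_nat_cond.
apply: eq_big => [q|q /andP[/andP[_ qp] /andP[pq _]]].
  case: (boolP (0 <= q < p)%N) => //= qp; case: (boolP (prime q)) => //= pq.
  by apply: dvdn_mul_prime => //; rewrite neq_ltn qp.
by rewrite dvdn2_mul_prime // neq_ltn qp.
Qed.

Lemma sfac_prime_mul p m : prime p -> sfac p (p * m) = sfac p m.
Proof.
move=> pp; rewrite /sfac big_nat_cond [in RHS]big_nat_cond.
apply: eq_bigl => q.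
case: (boolP (0 <= q < p)%N) => //= qp; case: (boolP (prime q)) => //= pq.
by apply: dvdn_mul_prime => //; rewrite neq_ltn qp.
Qed.

(** The cutoff [z] exists for this recursion: averages are estimated by adjoining one prime at a
    time, and [afac_large] removes the cutoff once it exceeds [n]. *)
Lemma afacS z n : afac z.+1 n =
  (if prime z && (z %| n)%N then
     if (z ^ 2 %| n)%N then 0 else z%:R / (z%:R - 2)
   else 1) * afac z n.
Proof. by rewrite /afac big_mkcond big_nat_recr //= -big_mkcond mulrC. Qed.

Lemma sfacS z n : sfac z.+1 n =
  (if prime z && (z %| n)%N then 1 + 6 / z%:R else 1) * sfac z n.
Proof. by rewrite /sfac big_mkcond big_nat_recr //= -big_mkcond mulrC. Qed.

Lemma afac_large z n : (0 < n < z)%N -> afac z n = afac n.+1 n.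
Proof.
move=> /andP[n0 nz]; rewrite /afac (big_cat_nat (leq0n n.+1) nz) //= [X in _ * X]big1_seq ?mulr1 //.
move=> p; rewrite mem_index_iota => /andP[/andP[_ pn] /andP[np _]].
by move: pn; rewrite gtnNdvd.
Qed.

Lemma afac1 z : afac z 1 = 1.
Proof.
rewrite /afac big1 // => p /andP[pp]; rewrite dvdn1 => /eqP p1.
by rewrite p1 in pp.
Qed.

Lemma afac_prime_mul_dvd p z d : prime p -> (p < z)%N -> (p %| d)%N -> afac z (p * d) = 0.
Proof.
move=> pp pz pd; rewrite /afac big_mkcond (bigD1_seq p) ?mem_index_iota ?iota_uniq //=.
by rewrite pp dvdn_mulr // expnS expn1 dvdn_pmul2l ?prime_gt0 // pd mul0r.
Qed.

Lemma afac_prime_mul_ndvd p z d : prime p -> (p < z)%N -> ~~ (p %| d)%N ->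
  afac z (p * d) = p%:R / (p%:R - 2) * afac z d.
Proof.
move=> pp pz pd; rewrite /afac !(big_mkcond (fun q => _ && _)).
rewrite !(bigD1_seq p) ?mem_index_iota ?iota_uniq //=.
rewrite pp dvdn_mulr // expnS expn1 dvdn_pmul2l ?prime_gt0 // (negbTE pd) mul1r.
congr (_ * _); apply: eq_bigr => q qp; case: (boolP (prime q)) => //= pq.
by rewrite dvdn_mul_prime // dvdn2_mul_prime.
Qed.

End MultiplicativeWeights.

(** * Averages of the weights *)

Section WeightedAverages.
Context {R : realType}.
Implicit Types (p q d n m z X M : nat).

Lemma prod_1D_le_expR (I : Type) (r : seq I) (P : pred I) (f : I -> R) :
  (forall i, P i -> 0 <= f i) ->
  \prod_(i <- r | P i) (1 + f i) <= expR (\sum_(i <- r | P i) f i).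
Proof.
move=> f0; rewrite expR_sum; apply: ler_prod => i Pi.
by rewrite addr_ge0 ?f0 //= expR_ge1Dx.
Qed.

Lemma sum_inv_sqr_le m n : (0 < m)%N ->
  \sum_(m <= k < n) (k%:R ^+ 2)^-1 <= 2 / m%:R :> R.
Proof.
move=> m0; have [mn|nm] := leqP m n; last by rewrite big_geq ?divr_ge0 // ltnW.
(* The stronger bound telescopes: 1/k^2 <= 2/k - 2/(k+1) for k >= 1. *)
suff H : \sum_(m <= k < n) (k%:R ^+ 2)^-1 <= 2 / m%:R - 2 / n%:R + 0 :> R.
  by apply: le_trans H _; rewrite addr0 gerBl divr_ge0.
elim: n mn => [|n IH]; first by rewrite leqNgt m0.
rewrite leq_eqVlt => /orP[/eqP <-|]; first by rewrite big_geq // subrr addr0.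
rewrite ltnS => mn; rewrite big_nat_recr //=.
apply: le_trans (lerD (IH mn) (lexx _)) _; rewrite !addr0 -lerBrDl.
have n0 : 0 < n%:R :> R by rewrite ltr0n (leq_trans m0).
rewrite opprD opprK addrACA subrr add0r [X in _ <= X]addrC -[n.+1%:R]natr1 -subr_ge0.
have -> : 2 / n%:R - 2 / (n%:R + 1) - (n%:R ^+ 2)^-1 = (n%:R - 1) / (n%:R ^+ 2 * (n%:R + 1)) :> R.
  by field; apply/andP; split; apply/eqP; nra.
apply: divr_ge0; last by nra.
by rewrite subr_ge0 ler1n (leq_trans m0).
Qed.

(* The sum of [sfac z n ^ 2] against a family of weights that is homogeneous under
   dilations by primes gains only a convergent Euler product: adjoining the prime
   [p] multiplies the bound by [1 + O(1/p^2)]. *)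
Lemma sum_sfac_sqr_le (w : R -> nat -> R) X (C : R) :
  (forall y n, 0 <= w y n) ->
  (forall y p m, 0 < y -> prime p -> w y (p * m)%N <= p%:R^-1 * w (y / p%:R) m) ->
  (forall y, 0 < y -> \sum_(1 <= n < X.+1) w y n <= C) ->
  forall z y, 0 < y -> \sum_(1 <= n < X.+1) sfac z n ^+ 2 * w y n <= C * expR 96.
Proof.
move=> w0 wp wC z.
have C0 : 0 <= C by apply: le_trans (wC 1 ltr01); apply: sumr_ge0.
(* The induction on [z] runs over all [y] at once because a prime [z] replaces [y] by [y / z]. The
   exponent 96 is 48 times the bound 2 for the sum of 1/p^2. *)
suff H y : 0 < y -> \sum_(1 <= n < X.+1) sfac z n ^+ 2 * w y n <=
    C * \prod_(1 <= p < z) (1 + 48 * (p%:R ^+ 2)^-1).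
  move=> y y0; apply: le_trans (H _ y0) _; apply: ler_wpM2l => //.
  apply: le_trans (prod_1D_le_expR _ _) _; first by move=> i _; rewrite mulr_ge0 ?invr_ge0 ?sqr_ge0.
  rewrite ler_expR -mulr_sumr; have := @sum_inv_sqr_le 1 z isT; rewrite divr1; lra.
elim: z y => [|z IH] y y0.
  rewrite [X in _ <= C * X]big_geq // mulr1; apply: le_trans (wC _ y0).
  by apply: ler_sum => n _; rewrite /sfac big_geq // expr1n mul1r.
have [->|z0] := posnP z.
  rewrite [X in _ <= C * X]big_geq // mulr1; apply: le_trans (wC _ y0).
  by apply: ler_sum => n _; rewrite sfacS /sfac big_geq //= mulr1 expr1n mul1r.
rewrite [X in _ <= _ * X]big_nat_recr //= mulrA.
have P0 : 0 <= C * \prod_(1 <= p < z) (1 + 48 * (p%:R ^+ 2)^-1).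
  apply: mulr_ge0 => //; apply: prodr_ge0 => p _.
  by rewrite addr_ge0 // mulr_ge0 ?invr_ge0 ?sqr_ge0.
have [pz|npz] := boolP (prime z); last first.
  apply: le_trans (_ : C * \prod_(1 <= p < z) (1 + 48 * (p%:R ^+ 2)^-1) <= _); last first.
    by rewrite ler_peMr // lerDl mulr_ge0 ?invr_ge0 ?sqr_ge0.
  apply: le_trans (IH _ y0); apply: ler_sum => n _.
  by rewrite sfacS (negbTE npz) /= mul1r.
(* [c] is (1 + 6/z)^2 - 1, the excess on multiples of [z]; dilation by [z] gains a factor 1/z, so c
   <= 48/z leads to the Euler factor 1 + 48/z^2. *)
set c : R := 12 / z%:R + 36 / z%:R ^+ 2.
have c0 : 0 <= c by rewrite addr_ge0 ?divr_ge0 ?sqr_ge0.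
have zR : 1 <= z%:R :> R by rewrite ler1n.
have cz : c <= 48 / z%:R.
  rewrite /c -subr_ge0.
  have -> : 48 / z%:R - (12 / z%:R + 36 / z%:R ^+ 2) = 36 * (z%:R - 1) / z%:R ^+ 2 :> R.
    by field; apply/eqP; nra.
  by apply: divr_ge0; nra.
have -> : \sum_(1 <= n < X.+1) sfac z.+1 n ^+ 2 * w y n =
    \sum_(1 <= n < X.+1) sfac z n ^+ 2 * w y n +
    c * \sum_(1 <= n < X.+1 | (z %| n)%N) sfac z n ^+ 2 * w y n.
  rewrite [X in _ + c * X]big_mkcond mulr_sumr -big_split /=; apply: eq_bigr => n _.
  rewrite sfacS pz /=; case: ifP => _; last by rewrite mul1r mulr0 addr0.
  rewrite /c; field; apply/eqP; nra.
rewrite sum_multiples //.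
have IHz : \sum_(1 <= m < (X %/ z).+1) sfac z (z * m) ^+ 2 * w y (z * m)%N <=
    z%:R^-1 * (C * \prod_(1 <= p < z) (1 + 48 * (p%:R ^+ 2)^-1)).
  have yz : 0 < y / z%:R by rewrite divr_gt0 // ltr0n.
  apply: le_trans (ler_wpM2l _ (IH _ yz)); last by rewrite invr_ge0.
  rewrite mulr_sumr [X in _ <= X](@big_cat_nat _ _ _ (X %/ z).+1) //=; last by rewrite ltnS leq_div.
  rewrite -[X in X <= _]addr0; apply: lerD; last first.
    by apply: sumr_ge0 => n _; rewrite mulr_ge0 ?invr_ge0 // mulr_ge0 ?sqr_ge0.
  apply: ler_sum => m _; rewrite sfac_prime_mul // mulrCA ler_wpM2l ?sqr_ge0 //.
  exact: wp.
apply: le_trans (lerD (IH _ y0) (ler_wpM2l c0 IHz)) _.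
rewrite mulrDr mulr1 lerD2l mulrA mulrC ler_wpM2l //.
by rewrite expr2 invfM mulrA ler_wpM2r ?invr_ge0.
Qed.

Lemma sum_sfac_sqr_div z X :
  \sum_(1 <= n < X.+1) sfac z n ^+ 2 / n%:R <=
  expR 96 * \sum_(1 <= n < X.+1) n%:R^-1 :> R.
Proof.
rewrite mulrC.
apply: (@sum_sfac_sqr_le (fun=> fun n => n%:R^-1) X _ _ _ _ z 1) => // y p m y0 pp.
by rewrite natrM invfM.
Qed.

Lemma sum_sfac_sqr z X : (0 < X)%N ->
  \sum_(1 <= n < X.+1) sfac z n ^+ 2 <= expR 96 * X%:R :> R.
Proof.
move=> X0; have X0R : 0 < X%:R :> R by rewrite ltr0n.
(* The indicator of n <= y divided by y obeys the dilation rule with equality and has sum at most 1;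
   it is used at y = X. *)
have := @sum_sfac_sqr_le (fun y n => if n%:R <= y then y^-1 * (0 < y)%R%:R else 0) X 1 _ _ _ z _ X0R.
rewrite mul1r => H; rewrite -ler_pdivrMr //; apply: le_trans (H _ _ _).
- rewrite mulr_suml; apply: ler_sum_nat => n /andP[_ nX].
  by rewrite ler_nat -ltnS nX X0R mulr1.
- move=> y n; case: ifP => // _; case: (ltrP 0 y) => y0; rewrite ?mulr0 // mulr1 invr_ge0; exact: ltW.
- move=> y p m y0 pp; have p0 : 0 < p%:R :> R by rewrite ltr0n prime_gt0.
  rewrite natrM y0 divr_gt0 // ler_pdivlMr // mulrC.
  case: ifP => _; last by rewrite mulr0.
  by rewrite !mulr1 invfM invrK mulrCA mulVf ?mulr1 // gt_eqF.
- move=> y y0; rewrite y0 mulr1.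
  have -> : \sum_(1 <= n < X.+1) (if n%:R <= y then y^-1 else 0) =
     \sum_(1 <= n < X.+1) (if n%:R <= y then 1 else 0) / y.
    by apply: eq_bigr => n _; case: ifP; rewrite ?mul1r ?mul0r.
  rewrite -mulr_suml.
  rewrite ler_pdivrMr // mul1r.
  elim: X {X0 X0R H} => [|X IH]; first by rewrite big_geq // ltW.
  case: (leP X.+1%:R y) => Xy.
    apply: le_trans Xy; apply: le_trans (_ : \sum_(1 <= n < X.+2) (1 : R) <= _).
      by apply: ler_sum => n _; case: ifP.
    by rewrite sumr_const_nat subn1.
  by rewrite big_nat_recr //= (lt_geF Xy) addr0.
Qed.

Lemma sum_sfac_sqr_tail z X (y : R) : 0 < y ->
  \sum_(1 <= n < X.+1 | y < n%:R) sfac z n ^+ 2 / n%:R ^+ 2 <= 2 * expR 96 / y.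
Proof.
move=> y0; rewrite big_mkcond ler_pdivlMr //.
have := @sum_sfac_sqr_le (fun y n => if y < n%:R then (0 < y)%R%:R * y / n%:R ^+ 2 else 0) X 2 _ _ _ z _ y0.
move=> H; apply: le_trans (H _ _ _).
- rewrite mulr_suml; apply: ler_sum => n _; rewrite y0 mul1r.
  by case: ifP; rewrite ?mul0r ?mulr0 // -mulrA [_^-1 * y]mulrC.
- move=> y' n; case: ifP => // _; case: (ltrP 0 y') => y'0; rewrite ?mul0r // mul1r.
  by apply: divr_ge0; [exact: ltW|rewrite sqr_ge0].
- move=> y' p m y'0 pp; have p0 : 0 < p%:R :> R by rewrite ltr0n prime_gt0.
  rewrite y'0 divr_gt0 // !mul1r ltr_pdivrMr // -natrM [(m * p)%N]mulnC.
  case: ifP => _; last by rewrite mulr0.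
  rewrite natrM exprMn invfM !mulrA [X in _ <= X * _](_ : _ = y' / p%:R ^+ 2).
    by rewrite mulrAC.
  by rewrite expr2 invfM [p%:R^-1 * _]mulrC mulrA.
- move=> y' y'0; rewrite y'0.
  (* [f n] is min(1, y'/n); since 2 (f n - f (n+1)) dominates each weight, the total is at most
     2. *)
  pose f n : R := if y' < n%:R then y' / n%:R else 1.
  have f1 n : f n <= 1.
    rewrite /f; case: ifP => // yn; rewrite ler_pdivrMr ?mul1r ?(ltW yn) //.
    exact: lt_trans yn.
  have fge n : 0 <= f n by rewrite /f; case: ifP => // _; rewrite divr_ge0 // ltW.
  apply: le_trans (_ : \sum_(1 <= n < X.+1) 2 * (f n - f n.+1) <= _).
    apply: ler_sum_nat => n /andP[n0 _].
    have n0R : 1 <= n%:R :> R by rewrite ler1n.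
    case: (ltrP y' n%:R) => yn; last first.
      by rewrite mulr_ge0 // subr_ge0 {2}/f ltNge yn.
    rewrite /f yn (lt_trans yn) ?ltr_nat // mul1r -[n.+1%:R]natr1.
    rewrite -subr_ge0.
    have -> : 2 * (y' / n%:R - y' / (n%:R + 1)) - y' / n%:R ^+ 2 =
       y' * (n%:R - 1) / (n%:R ^+ 2 * (n%:R + 1)).
      by field; apply/andP; split; apply/eqP; nra.
    by apply: divr_ge0; nra.
  rewrite -mulr_sumr -[X in _ <= X]mulr1 ler_wpM2l // (@telescope_sumr_eq R 1 X.+1 (fun n => - f n)) //.
    by rewrite opprK addrC; have := f1 1%N; have := fge X.+1; lra.
  by move=> k _; rewrite opprK addrC.
Qed.

End WeightedAverages.

(** * The singular series as a divisor sum *)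

Section SingularSeries.
Context {R : realType}.
Implicit Types (p q d n m z X M N : nat).

(** For k = p^(v+1) m with p not dividing m, the divisors that contribute are d and p d with d
    dividing m; multiples of p^2 give 0. Allowing any bound [X] above [k] lets the induction pass to
    [X %/ p]. *)
Lemma sum_dvdn_eq (g x : nat -> R) :
  g 1%N = 1 ->
  (forall p d, prime p -> (0 < d)%N -> ~~ (p %| d)%N -> g (p * d)%N = x p * g d) ->
  (forall p d, prime p -> (0 < d)%N -> (p %| d)%N -> g (p * d)%N = 0) ->
  forall k X, (0 < k <= X)%N ->
  \sum_(1 <= d < X.+1 | (d %| k)%N) g d = \prod_(p <- primes k) (1 + x p).
Proof.
move=> g1 gp gpp k; have [K] := ubnP k; elim: K k => // K IH k kK X /andP[k0 kX].
have [k1|k1] := leqP k 1.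
  have -> : k = 1%N by apply/eqP; rewrite eqn_leq k1.
  rewrite [RHS]big_nil big_mkcond (bigD1_seq 1%N) ?mem_index_iota ?iota_uniq //=; last first.
    by rewrite ltnS (leq_trans k0).
  by rewrite g1 big1 ?addr0 // => d; rewrite dvdn1 => /negbTE ->.
set p := pdiv k; have pp : prime p by apply: pdiv_prime.
have [m cpm km] := pfactor_coprime pp k0.
have v0 : (0 < logn p k)%N by rewrite logn_gt0 mem_primes pp k0 pdiv_dvd.
move: km v0; set v := logn p k; case: v => // v km _.
have m0 : (0 < m)%N by move: k0; rewrite km muln_gt0 => /andP[].
have pm : ~~ (p %| m)%N by rewrite -prime_coprime.
have mk : (m * p <= k)%N by rewrite km expnSr mulnA leq_mul2r leq_pmulr ?orbT // expn_gt0 prime_gt0.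
have mltk : (m < k)%N by apply: leq_trans mk; rewrite ltn_Pmulr // prime_gt1.
have mX : (m <= X)%N by rewrite (leq_trans (ltnW mltk)).
have mXp : (m <= X %/ p)%N by rewrite leq_divRL ?prime_gt0 // (leq_trans mk).
have dvdk d j : ~~ (p %| d)%N -> (d %| m * p ^ j)%N = (d %| m)%N.
  by move=> pd; rewrite Gauss_dvdl // coprimeXr // coprime_sym prime_coprime.
have perm_k : perm_eq (primes k) (p :: primes m).
  apply: uniq_perm; rewrite ?primes_uniq //=; first by rewrite mem_primes pp m0 /= pm primes_uniq.
  move=> q; rewrite inE km primesM // ?expn_gt0 ?prime_gt0 // primesX // (primes_prime pp).
  by rewrite mem_seq1 orbC.
rewrite (perm_big _ perm_k) /= big_cons mulrDl mul1r.
rewrite -(IH m _ X) ?m0 //; last by rewrite (leq_trans mltk).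
rewrite (bigID (fun d => ~~ (p %| d)%N)) /=; congr (_ + _).
  apply: eq_bigl => d; case: (boolP (p %| d)%N) => /= pd; last by rewrite andbT km dvdk.
  rewrite andbF; apply/esym/negbTE; apply: contra pm => dm; exact: dvdn_trans dm.
rewrite (IH m _ X) ?m0 //; last by rewrite (leq_trans mltk).
rewrite -(IH m _ (X %/ p)%N) ?m0 //; last by rewrite (leq_trans mltk).
transitivity (\sum_(1 <= d < X.+1 | (p %| d)%N) (if (d %| k)%N then g d else 0)).
  rewrite big_mkcond [RHS]big_mkcond; apply: eq_bigr => d _; rewrite negbK.
  by case: (d %| k)%N; case: (p %| d)%N.
rewrite sum_multiples ?prime_gt0 // [in RHS]big_mkcond mulr_sumr; apply: eq_big_nat => d /andP[d0 _].
rewrite km expnS mulnCA dvdn_pmul2l ?prime_gt0 //.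
case: (boolP (p %| d)%N) => pd; last by rewrite dvdk // gp //; case: ifP; rewrite ?mulr0.
rewrite gpp // if_same; case: ifP => [dm|]; last by rewrite mulr0.
by rewrite (dvdn_trans pd dm) in pm.
Qed.

(* The multiplicative function h of the header. *)
Definition hfac d : R := afac d.+1 d / d%:R.

Lemma hfac_ge0 d : 0 <= hfac d.
Proof. by rewrite divr_ge0 // afac_ge0. Qed.

Lemma hfac1 : hfac 1 = 1.
Proof. by rewrite /hfac afac1 divr1. Qed.

Lemma hfac_prime_mul_dvd p d : prime p -> (0 < d)%N -> (p %| d)%N -> hfac (p * d) = 0.
Proof.
by move=> pp d0 pd; rewrite /hfac afac_prime_mul_dvd ?mul0r // ltnS leq_pmulr.
Qed.

Lemma hfac_prime_mul_ndvd p d : prime p -> (0 < d)%N -> ~~ (p %| d)%N ->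
  hfac (p * d) = (p%:R - 2)^-1 * hfac d.
Proof.
move=> pp d0 pd; rewrite /hfac afac_prime_mul_ndvd ?ltnS ?leq_pmulr //.
rewrite afac_large; last by rewrite d0 ltnS leq_pmull ?prime_gt0.
rewrite natrM invfM -!mulrA mulrCA; congr (_ * _).
rewrite mulrCA; congr (_ * _); rewrite mulrA mulfV ?mul1r //.
by rewrite pnatr_eq0 -lt0n prime_gt0.
Qed.

Lemma hfac_even d : (0 < d)%N -> (2 %| d)%N -> hfac d = 0.
Proof.
move=> d0 /dvdnP[c dc]; rewrite dc mulnC; have c0 : (0 < c)%N by case: c dc d0 => // ->.
have [c2|c2] := boolP (2 %| c)%N; first exact: hfac_prime_mul_dvd.
by rewrite hfac_prime_mul_ndvd // subrr invr0 mul0r.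
Qed.

Lemma singular_series_eq (k : nat) X : (0 < k <= X)%N ->
  singular_series R k%:Z =
  2 * C2 R * \sum_(1 <= d < X.+1 | (2 * d %| k)%N) hfac d.
Proof.
move=> kX; have /andP[k0 _] := kX; rewrite /singular_series /=.
have -> : (2 %| k%:Z)%Z = (2 %| k)%N by [].
case: ifP => k2; last first.
  rewrite big1 ?mulr0 // => d /(dvdn_trans (dvdn_mulr d (dvdnn 2))).
  by rewrite k2.
congr (_ * _).
(* (p-1)/(p-2) = 1 + 1/(p-2) for odd p, and at [p = 2] the right side is 1 because 1/0 = 0, so the
   prime 2 may be included. *)
transitivity (\prod_(p <- primes k) (1 + (p%:R - 2)^-1) : R).
  rewrite big_mkcond; apply: eq_big_seq => p; rewrite mem_primes => /and3P[pp _ _].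
  case: ifP => p2; last first.
    have -> : p = 2%N by apply/eqP; rewrite eqn_leq prime_gt1 // leqNgt p2.
    by rewrite subrr invr0 addr0.
  have p3 : 3 <= p%:R :> R by rewrite ler_nat.
  by field; apply/eqP; lra.
rewrite -(@sum_dvdn_eq hfac (fun p => (p%:R - 2)^-1) _ _ _ k X) //; last first.
- exact: hfac_prime_mul_dvd.
- exact: hfac_prime_mul_ndvd.
- exact: hfac1.
rewrite big_mkcond [RHS]big_mkcond; apply: eq_big_nat => d /andP[d0 _].
have [d2|d2] := boolP (2 %| d)%N; first by rewrite hfac_even // !if_same.
by rewrite Gauss_dvd ?k2 // prime_coprime.
Qed.

Definition C2n n : R := \prod_(3 <= p < n | prime p) (1 - ((p%:R - 1) ^+ 2)^-1).

Lemma C2_factor_bounds p : (3 <= p)%N ->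
  0 < 1 - ((p%:R - 1) ^+ 2)^-1 :> R /\ ((p%:R - 1) ^+ 2)^-1 <= 1 :> R.
Proof.
move=> p3; have pR : 3 <= p%:R :> R by rewrite ler_nat.
have h : ((p%:R - 1) ^+ 2)^-1 <= 4^-1 :> R by rewrite lef_pV2 ?posrE; nra.
by split; lra.
Qed.

Lemma C2n_gt0 n : 0 < C2n n.
Proof.
rewrite /C2n big_nat_cond; apply: prodr_gt0 => p /andP[/andP[p3 _] _].
by have [] := C2_factor_bounds p3.
Qed.

(** Weierstrass product inequality; the induction carries the signs of the sum and of the product
    along. *)
Lemma prod_1B_ge (I : eqType) (r : seq I) (P : pred I) (f : I -> R) :
  (forall i, i \in r -> P i -> 0 <= f i <= 1) ->
  1 - \sum_(i <- r | P i) f i <= \prod_(i <- r | P i) (1 - f i) <= 1.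
Proof.
move=> f01; rewrite [\sum_(i <- r | P i) f i]big_seq_cond [\prod_(i <- r | P i) _]big_seq_cond.
suff : [/\ 1 - \sum_(i <- r | (i \in r) && P i) f i <= \prod_(i <- r | (i \in r) && P i) (1 - f i),
   0 <= \sum_(i <- r | (i \in r) && P i) f i,
   0 <= \prod_(i <- r | (i \in r) && P i) (1 - f i) &
   \prod_(i <- r | (i \in r) && P i) (1 - f i) <= 1] by case=> -> _ _ ->.
elim/big_ind2: _ => [|x1 x2 y1 y2 [h1 h2 h3 h4] [k1 k2 k3 k4]|i /andP[ir Pi]].
- by split; lra.
- by split; nra.
- by have /andP[] := f01 i ir Pi; split; lra.
Qed.

(** The primes from [z] on contribute a factor of at least 1 minus the sum of 1/(p-1)^2, and that
    sum is at most 2/(z-1) <= 4/z. *)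
Lemma C2n_le_ge z n : (3 <= z <= n)%N ->
  C2n z * (1 - 4 / z%:R) <= C2n n <= C2n z.
Proof.
move=> /andP[z3 zn]; rewrite {2 3}/C2n (big_cat_nat z3 zn) /= -/(C2n z).
have [|h1 h2] := andP (@prod_1B_ge _ (index_iota z n) prime (fun p => ((p%:R - 1) ^+ 2)^-1) _).
  move=> p; rewrite mem_index_iota => /andP[zp _] _.
  have [_ ->] := C2_factor_bounds (leq_trans z3 zp).
  by rewrite invr_ge0 sqr_ge0.
have C0 := C2n_gt0 z; apply/andP; split; last by rewrite ler_piMr // ltW.
rewrite ler_wpM2l ?(ltW C0) //; apply: le_trans h1; rewrite lerD2l lerN2.
have z1 : (0 < z.-1)%N by case: (z) z3 => [|[]].
have zR : 3 <= z%:R :> R by rewrite ler_nat.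
apply: le_trans (_ : 2 / z.-1%:R <= _); last first.
  have -> : z.-1%:R = z%:R - 1 :> R by rewrite -subn1 natrB // (leq_trans _ z3).
  by rewrite ler_pdivrMr 1?mulrAC ?ler_pdivlMr; lra.
apply: le_trans (@sum_inv_sqr_le R z.-1 n.-1 z1).
rewrite -[X in \sum_(X <= _ < _ | _) _](prednK (leq_trans (isT : (0 < 3)%N) z3)).
rewrite -[X in \sum_(_ <= _ < X | _) _](prednK (leq_trans (leq_trans (isT : (0 < 3)%N) z3) zn)).
rewrite big_mkcond big_add1 /=; apply: ler_sum => p _.
case: ifP => _; last by rewrite invr_ge0 sqr_ge0.
by rewrite -natr1 addrK.
Qed.

Lemma C2_le_ge z : (3 <= z)%N -> C2n z * (1 - 4 / z%:R) <= C2 R <= C2n z.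
Proof.
move=> z3; have ni : nonincreasing_seq (fun n => C2n n).
  apply/nonincreasing_seqP => n; rewrite /C2n; have [n3|n3] := leqP 3 n; last first.
    by rewrite !big_geq // ltnW.
  rewrite [X in X <= _]big_mkcond [X in _ <= X]big_mkcond big_nat_recr //= -!big_mkcond -/(C2n n).
  have C0 := C2n_gt0 n; have [h1 h2] := C2_factor_bounds n3.
  case: ifP => _; last by rewrite mulr1.
  by rewrite ler_piMr ?(ltW C0) // gerBl invr_ge0 sqr_ge0.
have cv : cvgn (fun n => C2n n).
  apply: nonincreasing_is_cvgn => //; exists 0 => _ [n _ <-]; exact/ltW/C2n_gt0.
rewrite /C2 -/(C2n _); apply/andP; split.
  apply: limr_ge => //; exists z => // n /= zn.
  by have /andP[] : C2n z * (1 - 4 / z%:R) <= C2n n <= C2n z by apply: C2n_le_ge; rewrite z3.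
exact: nonincreasing_cvgn_ge.
Qed.

Lemma C2_gt0 : 0 < C2 R.
Proof.
have /andP[h _] := C2_le_ge (isT : (3 <= 5)%N); apply: lt_le_trans h.
by rewrite mulr_gt0 ?C2n_gt0 //; lra.
Qed.

Lemma C2_le1 : C2 R <= 1.
Proof.
by have /andP[_ h] := C2_le_ge (isT : (3 <= 3)%N); apply: le_trans h _; rewrite /C2n big_geq.
Qed.

Lemma prime_dvd_fact p N : prime p -> (p %| N`!)%N = (p <= N)%N.
Proof.
move=> pp; elim: N => [|N IH]; first by rewrite fact0 dvdn1 leqNgt prime_gt0 // (gtn_eqF (prime_gt1 pp)).
rewrite factS Euclid_dvdM // IH; apply/orP/idP => [[/dvdn_leq->//|/leqW//]|].
by rewrite leq_eqVlt ltnS => /orP[/eqP ->|->]; [left|right].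
Qed.

(* The Euler product of [1 + h(p)/p] over [p <= N] is the sum of [h(d)/d] over the
   divisors of [N!]; the divisors beyond [N] contribute [O(1/N)]. *)
Lemma C2_sum_hfac_div N : (2 <= N)%N ->
  1 - (4 + 2 * expR 96) / N%:R <= C2 R * \sum_(1 <= d < N.+1) hfac d / d%:R <= 1.
Proof.
move=> N2; have N2R : 2 <= N%:R :> R by rewrite ler_nat.
have NF : (N <= N`!)%N by apply: dvdn_leq; rewrite ?fact_gt0 // dvdn_fact // leqnn (leq_trans _ N2).
(* Local factors cancel: for p >= 3, 1 + 1/(p(p-2)) = (p-1)^2/(p(p-2)) is the inverse of 1 -
   1/(p-1)^2. The factor at 2 is 1. *)
have prodE : (\sum_(1 <= d < N`!.+1 | (d %| N`!)%N) hfac d / d%:R) * C2n N.+1 = 1.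
  rewrite (@sum_dvdn_eq (fun d => hfac d / d%:R) (fun p => (p%:R - 2)^-1 / p%:R)) ?fact_gt0 ?leqnn //; first last.
  - by move=> p d pp d0 pd; rewrite hfac_prime_mul_dvd ?mul0r.
  - by move=> p d pp d0 pd; rewrite hfac_prime_mul_ndvd // natrM invfM mulrACA.
  - by rewrite hfac1 divr1.
  have -> : \prod_(p <- primes N`!) (1 + (p%:R - 2)^-1 / p%:R) =
            \prod_(3 <= p < N.+1 | prime p) (1 + (p%:R - 2)^-1 / p%:R) :> R.
    rewrite (perm_big [seq p <- index_iota 2 N.+1 | prime p]) /=; last first.
      apply: uniq_perm; rewrite ?primes_uniq ?filter_uniq ?iota_uniq // => p.
      rewrite mem_primes fact_gt0 mem_filter mem_index_iota ltnS.
      by case: (boolP (prime p)) => //= pp; rewrite prime_dvd_fact // prime_gt1.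
    rewrite big_filter big_mkcond big_ltn ?ltnS //= subrr invr0 mul0r addr0 mul1r.
    by rewrite -big_mkcond.
  rewrite /C2n -big_split /= big_nat_cond big1 // => p /andP[/andP[p3 _] _].
  have pR : 3 <= p%:R :> R by rewrite ler_nat.
  by field; apply/andP; split; [|apply/andP; split]; apply/eqP; lra.
set T := \sum_(1 <= d < N`!.+1 | (d %| N`!)%N) hfac d / d%:R in prodE *.
have TE : T = \sum_(1 <= d < N.+1) hfac d / d%:R +
     \sum_(N.+1 <= d < N`!.+1 | (d %| N`!)%N) hfac d / d%:R.
  rewrite /T (big_cat_nat (isT : (1 <= N.+1)%N)) ?ltnS //=; congr (_ + _).
  rewrite big_nat_cond [RHS]big_nat_cond; apply: eq_bigl => d; rewrite andbT.
  by case: (boolP (1 <= d < N.+1)%N) => //= /andP[d0 dN]; rewrite dvdn_fact // d0 -ltnS.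
set B := \sum_(N.+1 <= d < N`!.+1 | (d %| N`!)%N) hfac d / d%:R in TE *.
have B0 : 0 <= B by apply: sumr_ge0 => d _; rewrite divr_ge0 ?hfac_ge0.
have BN : B <= 2 * expR 96 / N%:R.
  have N0 : 0 < N%:R :> R by lra.
  apply: le_trans (@sum_sfac_sqr_tail R N`!.+1 N`! _ N0).
  rewrite [X in _ <= X](big_cat_nat (isT : (1 <= N.+1)%N)) ?ltnS //= -[B]add0r; apply: lerD.
    by apply: sumr_ge0 => d _; rewrite divr_ge0 ?sqr_ge0.
  rewrite /B big_mkcond [X in _ <= X]big_mkcond /=; apply: ler_sum_nat => d /andP[Nd dF].
  rewrite ltr_nat Nd; have d0 : (0 < d)%N by apply: leq_trans Nd.
  apply: le_trans (_ : hfac d / d%:R <= _).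
    by case: ifP => // _; rewrite divr_ge0 ?hfac_ge0.
  rewrite /hfac -mulrA -invfM -expr2 ler_wpM2r ?invr_ge0 ?sqr_ge0 //.
  rewrite -(@afac_large _ N`!.+1) ?d0 //; apply: le_trans (afac_le_sfac _ _) _.
  by rewrite expr2 ler_peMl ?sfac_ge0 ?sfac_ge1.
have /andP[h1 h2] := C2_le_ge (N2 : (3 <= N.+1)%N).
have C0 := C2n_gt0 N.+1; have := C2_gt0; have := C2_le1 => c1 c0.
have -> : \sum_(1 <= d < N.+1) hfac d / d%:R = T - B by rewrite TE addrK.
have T0 : 0 < T by rewrite -(pmulr_lgt0 _ C0) prodE.
have e0 : 0 <= 2 * expR 96 / N%:R :> R by rewrite divr_ge0 // mulr_ge0 // expR_ge0.
have h3 : 1 - 4 / N.+1%:R <= C2 R * T.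
  apply: le_trans (ler_wpM2r (ltW T0) h1).
  by rewrite mulrAC [C2n _ * T]mulrC prodE mul1r.
have h4 : C2 R * T <= 1 by rewrite -prodE mulrC ler_wpM2l // ltW.
have h5 : 4 / N.+1%:R <= 4 / N%:R :> R.
  by rewrite ler_pM2l // lef_pV2 ?posrE ?ler_nat // ltr0n (leq_trans _ N2).
have h6 : C2 R * B <= 2 * expR 96 / N%:R.
  apply: le_trans BN; rewrite ler_piMl //.
have h7 : 0 <= C2 R * B by rewrite mulr_ge0 // ltW.
rewrite mulrDl mulrBr; move: h3 h4 h5 h6 h7.
move: (4 / N.+1%:R) (4 / N%:R) (2 * expR 96 / N%:R) (C2 R * T) (C2 R * B) => a b c d e *.
by apply/andP; split; lra.
Qed.

End SingularSeries.

(** * Logarithmic mean of the coefficients *)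

Section LogarithmicMean.
Context {R : realType}.
Implicit Types (p q d n m z X M N : nat).

Lemma ln_natS_le n : (0 < n)%N -> ln n.+1%:R <= ln n%:R + n%:R^-1 :> R.
Proof.
move=> n0; have n0R : 0 < n%:R :> R by rewrite ltr0n.
rewrite -lerBlDl -ln_div ?posrE ?ltr0n // -natr1 mulrDl mulfV ?gt_eqF // div1r.
have := @le_ln1Dx R n%:R^-1; apply; rewrite (lt_trans (ltrN10 _)) // invr_gt0 //.
Qed.

Lemma ln_natS_ge n : (0 < n)%N -> ln n%:R + n.+1%:R^-1 <= ln n.+1%:R :> R.
Proof.
move=> n0; have n0R : 0 < n%:R :> R by rewrite ltr0n.
have n1R : 0 < n.+1%:R :> R by rewrite ltr0n.
rewrite addrC -lerBrDr -lerN2 opprB -ln_div ?posrE //.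
have -> : n%:R / n.+1%:R = 1 + (- n.+1%:R^-1) :> R.
  by rewrite -[n%:R](addrK 1) natr1 mulrBl mulfV ?gt_eqF // mul1r.
apply: le_ln1Dx; rewrite ltrN2 invf_lt1 // ltr1n ltnS //.
Qed.

Lemma harmonic_sum_bounds X : (0 < X)%N ->
  ln X%:R <= \sum_(1 <= n < X.+1) (n%:R^-1 : R) <= 1 + ln X%:R.
Proof.
move=> X0; apply/andP; split.
  apply: le_trans (_ : ln X.+1%:R <= _); first by rewrite ler_ln ?posrE ?ltr0n // ler_nat.
  elim: X {X0} => [|X IH]; first by rewrite big_geq // ln1.
  rewrite big_nat_recr //=; apply: le_trans (ln_natS_le _) _ => //.
  by rewrite lerD2r.
elim: X X0 => // -[|X] IH _; first by rewrite big_nat1 ln1 invr1 addr0.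
rewrite big_nat_recr //=; apply: le_trans (lerD (IH isT) (lexx _)) _.
by rewrite -addrA lerD2l ln_natS_ge.
Qed.

Lemma ln_nat_div p : (0 < p)%N ->
  forall X, `|ln (X %/ p)%:R - ln X%:R| <= ln (2 * p%:R) :> R.
Proof.
move=> p0 X; have p1 : 1 <= p%:R :> R by rewrite ler1n.
have lp : 0 <= ln (2 * p%:R) :> R by apply: ln_ge0; lra.
have [Xp|pX] := ltnP X p.
  (* The quotient is 0 here, and [ln 0] is 0 by convention. *)
  rewrite divn_small // [ln 0]ln0 ?lexx // sub0r normrN.
  case: X Xp => [|X] Xp; first by rewrite ln0 ?normr0.
  rewrite ger0_norm ?ln_ge0 ?ler1n // ler_ln ?posrE ?ltr0n //; last by lra.
  apply: le_trans (_ : p%:R <= _); last by lra.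
  by rewrite ler_nat ltnW.
have q0 : (0 < X %/ p)%N by rewrite divn_gt0.
have qR : 1 <= (X %/ p)%:R :> R by rewrite ler1n.
have XR : (X %/ p)%:R <= X%:R :> R by rewrite ler_nat leq_div.
have X2 : X%:R <= 2 * p%:R * (X %/ p)%:R :> R.
  rewrite -!natrM ler_nat; apply: leq_trans (ltnW (ltn_ceil X p0)) _.
  by rewrite mulnC -mulnA mulnCA leq_mul2l; apply/orP; right; lia.
have h1 : ln (X %/ p)%:R <= ln X%:R :> R by rewrite ler_ln ?posrE //; lra.
have h2 : ln X%:R <= ln (2 * p%:R) + ln (X %/ p)%:R :> R.
  by rewrite -lnM ?posrE; [rewrite ler_ln ?posrE //; nra|lra|lra].
by rewrite ler_norml; apply/andP; split; lra.
Qed.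

(** With [z > X] this is the sum of h(d) over d <= X, with [z = 0] the harmonic sum; increasing [z]
    leads from one to the other prime by prime. *)
Definition hsum z X : R := \sum_(1 <= n < X.+1) afac z n / n%:R.

Lemma hsum_ge0 z X : 0 <= hsum z X.
Proof. by apply: sumr_ge0 => n _; rewrite divr_ge0 ?afac_ge0. Qed.

Lemma hsum_mono z X M : (X <= M)%N -> hsum z X <= hsum z M.
Proof.
move=> XM; rewrite [X in _ <= X](@big_cat_nat _ _ _ X.+1) //= lerDl.
by apply: sumr_ge0 => n _; rewrite divr_ge0 ?afac_ge0.
Qed.

(** The factor at a prime [z] is 1 off the multiples of [z], z/(z-2) on multiples not divisible by
    z^2, and 0 on the rest. Both sums over multiples rescale because [afac z] ignores factors
    [z]. *)
Lemma hsumS z X : hsum z.+1 X =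
  if prime z then
    hsum z X + ((z%:R - 2)^-1 - z%:R^-1) * hsum z (X %/ z)
             - (z%:R - 2)^-1 / z%:R * hsum z (X %/ z ^ 2)
  else hsum z X.
Proof.
case: ifP => pz; last by apply: eq_bigr => n _; rewrite afacS pz /= mul1r.
have z0 : (0 < z)%N by rewrite prime_gt0.
have zR : z%:R != 0 :> R by rewrite pnatr_eq0 -lt0n.
have E1 : \sum_(1 <= n < X.+1 | (z %| n)%N) afac z n / n%:R = z%:R^-1 * hsum z (X %/ z) :> R.
  rewrite sum_multiples // /hsum mulr_sumr; apply: eq_bigr => m _.
  by rewrite afac_prime_mul // natrM invfM mulrCA.
have E2 : \sum_(1 <= n < X.+1 | (z ^ 2 %| n)%N) afac z n / n%:R =
    (z%:R ^+ 2)^-1 * hsum z (X %/ z ^ 2) :> R.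
  rewrite sum_multiples ?expn_gt0 ?z0 // /hsum mulr_sumr; apply: eq_bigr => m _.
  by rewrite expnS expn1 -mulnA !afac_prime_mul // mulnA natrM natrM -expr2 invfM mulrCA.
have -> : hsum z.+1 X = hsum z X
   + (z%:R / (z%:R - 2) - 1) * \sum_(1 <= n < X.+1 | (z %| n)%N) afac z n / n%:R
   - z%:R / (z%:R - 2) * \sum_(1 <= n < X.+1 | (z ^ 2 %| n)%N) afac z n / n%:R.
  rewrite /hsum [in X in _ + X - _]big_mkcond [in X in _ - X]big_mkcond !mulr_sumr.
  rewrite -big_split -sumrB /=; apply: eq_bigr => n _; rewrite afacS pz /=.
  case: (boolP (z ^ 2 %| n)%N) => z2n.
    by rewrite (dvdn_trans _ z2n) ?expnS ?dvdn_mulr //; ring.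
  by case: ifP => _; ring.
rewrite E1 E2; move: (z%:R - 2)^-1 => x; field.
exact: zR.
Qed.

(** Euler product for the mean value of [afac z]; the factor at 2 is 1/2. *)
Definition hmean z : R := \prod_(0 <= p < z | prime p) ((1 - p%:R^-1) * (1 + (p%:R - 2)^-1)).

(** In the recursion ln(X/p) differs from ln X by O(1), so each prime multiplies the coefficient of
    ln X by its local mean. Since [B] depends on [z], the cutoff has to stay fixed while [X]
    grows. *)
Lemma hsum_asymp z : exists2 B : R, 0 <= B & forall X, `|hsum z X - hmean z * ln X%:R| <= B.
Proof.
elim: z => [|z [B B0 IH]].
  exists 1 => // X; rewrite /hmean big_geq // mul1r.
  have -> : hsum 0 X = \sum_(1 <= n < X.+1) n%:R^-1.
    by apply: eq_bigr => n _; rewrite /afac big_geq // mul1r.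
  case: X => [|X]; first by rewrite big_geq // ln0 // subrr normr0.
  have /andP[h1 h2] := @harmonic_sum_bounds X.+1 isT.
  by rewrite ler_norml; apply/andP; split; lra.
rewrite /hmean big_mkcond big_nat_recr //= -big_mkcond /= -/(hmean z).
have [pz|pz] := boolP (prime z); last first.
  by exists B => // X; rewrite hsumS (negbTE pz) mulr1.
have z0 : (0 < z)%N by rewrite prime_gt0.
have zR : z%:R != 0 :> R by rewrite pnatr_eq0 -lt0n.
set x : R := (z%:R - 2)^-1; set c := hmean z; set u : R := z%:R^-1.
set L1 : R := ln (2 * z%:R); set L2 : R := ln (2 * (z ^ 2)%:R).
exists (B + `|x - u| * (B + `|c| * L1) + `|x * u| * (B + `|c| * L2)).
  by rewrite !addr_ge0 ?mulr_ge0 // ?addr_ge0 ?mulr_ge0 ?(le_trans _ (ln_nat_div _ 0)) ?expn_gt0 ?z0.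
move=> X; rewrite hsumS pz -/x -/u.
have h1 := IH X.
have h2 : `|hsum z (X %/ z) - c * ln X%:R| <= B + `|c| * L1.
  rewrite -[hsum _ _](subrK (c * ln (X %/ z)%:R)) -addrA -mulrBr.
  rewrite (le_trans (ler_normD _ _)) // lerD ?IH // normrM ler_wpM2l //; exact: ln_nat_div.
have h3 : `|hsum z (X %/ z ^ 2) - c * ln X%:R| <= B + `|c| * L2.
  rewrite -[hsum _ _](subrK (c * ln (X %/ z ^ 2)%:R)) -addrA -mulrBr.
  rewrite (le_trans (ler_normD _ _)) // lerD ?IH // normrM ler_wpM2l //; apply: ln_nat_div.
  by rewrite expn_gt0 z0.
have -> : hsum z X + (x - u) * hsum z (X %/ z) - x * u * hsum z (X %/ z ^ 2) -
    c * ((1 - u) * (1 + x)) * ln X%:R =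
   (hsum z X - c * ln X%:R) + (x - u) * (hsum z (X %/ z) - c * ln X%:R)
   + - (x * u) * (hsum z (X %/ z ^ 2) - c * ln X%:R) by ring.
rewrite (le_trans (ler_normD _ _)) // lerD //; last first.
  by rewrite normrM normrN ler_wpM2l.
by rewrite (le_trans (ler_normD _ _)) // lerD // normrM ler_wpM2l.
Qed.

(** For odd p the local factors cancel, and the factor 1/2 at the prime 2 absorbs the 2. Hence the
    sum of the coefficients 2 C_2 h(d) has leading term exactly log X. *)
Lemma hmean_C2n z : (3 <= z)%N -> 2 * C2n z * hmean z = 1 :> R.
Proof.
move=> z3; rewrite /hmean (big_cat_nat (leq0n 3) z3) /=.
rewrite [X in _ * (X * _)](_ : _ = 2^-1); last first.
  by rewrite big_mkcond !big_nat_recr //= big_geq //= !mul1r subrr invr0; lra.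
rewrite mulrACA divff ?pnatr_eq0 // mul1r.
rewrite /C2n -big_split /= big_nat_cond big1 // => p /andP[/andP[p3 _] _].
have pR : 3 <= p%:R :> R by rewrite ler_nat.
by field; apply/andP; split; [|apply/andP; split]; apply/eqP; lra.
Qed.

(** Both coefficients of the recursion are at most 2/(z(z-2)) <= 6/z^2, with equality in the last
    step at [z = 3], and shortening the range only decreases [hsum]. *)
Lemma hsum_step z X : (3 <= z)%N ->
  (1 - 6 * (z%:R ^+ 2)^-1) * hsum z X <= hsum z.+1 X <= (1 + 6 * (z%:R ^+ 2)^-1) * hsum z X.
Proof.
move=> z3; have zR : 3 <= z%:R :> R by rewrite ler_nat.
have e0 : 0 <= 6 * (z%:R ^+ 2)^-1 :> R by rewrite mulr_ge0 // invr_ge0 sqr_ge0.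
have H0 := hsum_ge0 z X; rewrite hsumS; case: ifP => pz; last by apply/andP; split; nra.
have h1 : hsum z (X %/ z) <= hsum z X by rewrite hsum_mono // leq_div.
have h2 : hsum z (X %/ z ^ 2) <= hsum z X by rewrite hsum_mono // leq_div.
have h3 := hsum_ge0 z (X %/ z); have h4 := hsum_ge0 z (X %/ z ^ 2).
have a0 : 0 <= (z%:R - 2)^-1 - z%:R^-1 :> R.
  by rewrite subr_ge0 lef_pV2 ?posrE; lra.
have a1 : (z%:R - 2)^-1 - z%:R^-1 <= 6 * (z%:R ^+ 2)^-1 :> R.
  rewrite -subr_ge0.
  have -> : 6 * (z%:R ^+ 2)^-1 - ((z%:R - 2)^-1 - z%:R^-1) =
     4 * (z%:R - 3) / (z%:R ^+ 2 * (z%:R - 2)) :> R.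
    by field; apply/andP; split; apply/eqP; lra.
  by apply: divr_ge0; nra.
have b0 : 0 <= (z%:R - 2)^-1 / z%:R :> R by rewrite divr_ge0 // invr_ge0; lra.
have b1 : (z%:R - 2)^-1 / z%:R <= 6 * (z%:R ^+ 2)^-1 :> R.
  rewrite -subr_ge0.
  have -> : 6 * (z%:R ^+ 2)^-1 - (z%:R - 2)^-1 / z%:R =
     (5 * z%:R - 12) / (z%:R ^+ 2 * (z%:R - 2)) :> R.
    by field; apply/andP; split; apply/eqP; lra.
  by apply: divr_ge0; nra.
move: a0 a1 b0 b1 e0; move: (_ - z%:R^-1) (_ / z%:R) (6 * _) => a b c *.
by apply/andP; split; nra.
Qed.

(** Uniformity in [X] and [Z] is the point: it passes from a fixed [z], where the asymptotics are
    known, to a cutoff beyond [X] at a relative cost of O(1/z). *)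
Lemma hsum_compare z Z X : (3 <= z <= Z)%N ->
  (1 - 12 / z%:R) * hsum z X <= hsum Z X <= expR (12 / z%:R) * hsum z X.
Proof.
move=> /andP[z3 zZ]; have z0 : (0 < z)%N by apply: leq_trans z3.
have S := @sum_inv_sqr_le R z Z z0.
have H0 := hsum_ge0 z X.
have : \prod_(z <= n < Z) (1 - 6 * (n%:R ^+ 2)^-1) * hsum z X <= hsum Z X <=
  \prod_(z <= n < Z) (1 + 6 * (n%:R ^+ 2)^-1) * hsum z X.
  elim: Z zZ {S} => [|Z IH]; first by rewrite leqNgt z0.
  rewrite leq_eqVlt => /orP[/eqP <-|]; first by rewrite !big_geq // !mul1r lexx.
  rewrite ltnS => zZ; have /andP[h1 h2] := IH zZ; rewrite !big_nat_recr //=.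
  have Z3 := leq_trans z3 zZ; have ZR : 3 <= Z%:R :> R by rewrite ler_nat.
  have /andP[k1 k2] := @hsum_step Z X Z3.
  have e0 : 0 <= 6 * (Z%:R ^+ 2)^-1 :> R by rewrite mulr_ge0 // invr_ge0 sqr_ge0.
  have e1 : 6 * (Z%:R ^+ 2)^-1 <= 1 :> R by rewrite ler_pdivrMr; nra.
  apply/andP; split.
    by apply: le_trans k1; rewrite mulrAC mulrC ler_wpM2l // subr_ge0.
  by apply: le_trans k2 _; rewrite [X in _ <= X]mulrAC [X in _ <= X]mulrC ler_wpM2l // addr_ge0.
move=> /andP[h1 h2]; apply/andP; split.
  apply: le_trans h1; rewrite ler_wpM2r //.
  have [|h _] := andP (@prod_1B_ge R _ (index_iota z Z) xpredT (fun n => 6 * (n%:R ^+ 2)^-1) _).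
    move=> n; rewrite mem_index_iota => /andP[zn _] _.
    have nR : 3 <= n%:R :> R by rewrite ler_nat (leq_trans z3).
    by rewrite mulr_ge0 ?invr_ge0 ?sqr_ge0 //= ler_pdivrMr; nra.
  by apply: le_trans h; rewrite -mulr_sumr; lra.
apply: le_trans h2 _; rewrite ler_wpM2r //.
apply: le_trans (prod_1D_le_expR _ _) _; first by move=> i _; rewrite mulr_ge0 ?invr_ge0 ?sqr_ge0.
by rewrite ler_expR -mulr_sumr; lra.
Qed.

Lemma expR_le_1D2x (t : R) : 0 <= t <= 2^-1 -> expR t <= 1 + 2 * t.
Proof.
move=> /andP[t0 t1]; have := @expR_ge1Dx R (- t); rewrite expRN => h.
have e0 := expR_gt0 t.
have : (1 - t) * expR t <= 1 by rewrite -ler_pdivlMr // div1r.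
by nra.
Qed.

Lemma sum_hfacE Z X : (X < Z)%N -> \sum_(1 <= d < X.+1) hfac d = hsum Z X :> R.
Proof.
move=> XZ; apply: eq_big_nat => d /andP[d0 dX]; rewrite /hfac afac_large //.
by rewrite d0 (leq_trans dX).
Qed.

Lemma C2_sum_hfac (eps : R) : 0 < eps -> exists2 B : R, 0 <= B & forall X,
  `|2 * C2 R * \sum_(1 <= d < X.+1) hfac d - ln X%:R| <= eps * ln X%:R + B.
Proof.
(* 32/z covers the relative losses: 4/z from [C2] and 12/z from [hsum_compare] below, 24/z above.
   The bound z >= 32 keeps 12/z under 1/2 for [expR_le_1D2x]. *)
move=> e0; pose z := maxn 32 (Num.bound (32 / eps)).
have z32 : 32 <= z%:R :> R by rewrite ler_nat leq_maxl.
have ze : 32 / z%:R <= eps.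
  rewrite ler_pdivrMr; last by lra.
  rewrite -ler_pdivrMl // mulrC; apply: le_trans (ltW (archi_boundP _)) _; first by rewrite divr_ge0 // ltW.
  by rewrite ler_nat leq_maxr.
have z3 : (3 <= z)%N by rewrite leq_max.
have [B B0 HB] := hsum_asymp z.
exists (2 * C2n z * B * (1 + eps)).
  by rewrite !mulr_ge0 ?(ltW (C2n_gt0 z)) //; lra.
move=> X.
have l0 : 0 <= ln X%:R :> R.
  by case: (X) => [|n]; [rewrite ln0|rewrite ln_ge0 // ler1n].
rewrite (@sum_hfacE (maxn z X.+1)) ?leq_max ?ltnSn ?orbT //.
have /andP[h1 h2] := @hsum_compare z (maxn z X.+1) X (introT andP (conj z3 (leq_maxl _ _))).
have /andP[c1 c2] := @C2_le_ge R z z3.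
have Cz := @C2n_gt0 R z; have C0 := @C2_gt0 R.
have H0 := hsum_ge0 z X; set H := hsum z X in h1 h2 H0 *; set K := hsum _ _ in h1 h2 *.
have u0 : 0 < z%:R^-1 :> R by rewrite invr_gt0; lra.
have u1 : z%:R^-1 <= 32^-1 :> R by rewrite lef_pV2 ?posrE; lra.
set u : R := z%:R^-1 in u0 u1 h1 h2 c1 ze *.
have h3 : K <= (1 + 24 * u) * H.
  apply: le_trans h2 _; rewrite ler_wpM2r //; have := @expR_le_1D2x (12 * u).
  by move=> /(_ _)/le_trans; apply; [apply/andP; split|]; lra.
have Q : `|2 * C2n z * H - ln X%:R| <= 2 * C2n z * B.
  have -> : 2 * C2n z * H - ln X%:R = 2 * C2n z * (H - hmean z * ln X%:R).
    by rewrite mulrBr mulrA hmean_C2n // mul1r.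
  by rewrite normrM gtr0_norm ?mulr_gt0 // ler_wpM2l ?HB // mulr_ge0 // ltW.
set D := 2 * C2n z * B in Q *.
have D0 : 0 <= D by apply: le_trans Q.
set q := 2 * C2n z * H in Q.
have q0 : 0 <= q by rewrite !mulr_ge0 // ltW.
have k1 : 2 * C2 R * K <= q * (1 + 24 * u).
  rewrite /q -!mulrA ler_wpM2l //; apply: le_trans (_ : C2n z * K <= _).
    by rewrite ler_wpM2r // /K hsum_ge0.
  by rewrite ler_wpM2l ?(ltW Cz) // mulrC.
have k2 : q * ((1 - 4 * u) * (1 - 12 * u)) <= 2 * C2 R * K.
  have p1 : 0 <= C2n z * (1 - 4 * u) by rewrite mulr_ge0 ?(ltW Cz) //; clear -u1; lra.
  have p2 : 0 <= (1 - 12 * u) * H by rewrite mulr_ge0 //; clear -u1; lra.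
  have h := ler_pM p1 p2 c1 h1; rewrite /q; clear -h; lra.
move: Q; rewrite ler_norml => /andP[Q1 Q2].
move: k1 k2; set k := 2 * C2 R * K => k1 k2.
have qle : q <= ln X%:R + D by lra.
have qe : q * (32 * u) <= (ln X%:R + D) * eps.
  by rewrite ler_pM //; clear -u0 qle; lra.
have k3 : q * (24 * u) <= q * (32 * u) by rewrite ler_wpM2l //; clear -u0; lra.
have k4 : q * (1 - 32 * u) <= k by apply: le_trans k2; rewrite ler_wpM2l //; clear -u0; nra.
by rewrite ler_norml; clear -k1 k3 k4 qe Q1 Q2; apply/andP; split; lra.
Qed.

End LogarithmicMean.

(** * The singular series on average *)

Section SingularSeriesOnAverage.
Context {R : realType}.
Implicit Types (p q d g n m z D M N : nat).

Lemma hfac_le z d : (0 < d < z)%N -> hfac d <= sfac z d / d%:R :> R.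
Proof.
move=> dz; rewrite /hfac ler_wpM2r ?invr_ge0 // -(afac_large dz).
exact: afac_le_sfac.
Qed.

Lemma sum_hfac_mul_le D : (0 < D)%N ->
  \sum_(1 <= d < D.+1) hfac d * d%:R <= expR 96 * D%:R :> R.
Proof.
move=> D0; apply: le_trans (@sum_sfac_sqr R D.+1 D D0).
apply: ler_sum_nat => d /andP[d0 dD].
apply: le_trans (ler_wpM2r _ (@hfac_le D.+1 d _)) _; rewrite ?d0 //.
rewrite divfK ?pnatr_eq0 -?lt0n // expr2 ler_peMl ?sfac_ge0 ?sfac_ge1 //.
Qed.

(** Writing d = g m, submultiplicativity splits off [sfac g]; the tail m > D/g of sfac(m)/m^2 is
    O(g/D), which turns 1/g^2 into 1/g. *)
Lemma sum_hfac_tail_multiples_le g D N : (0 < g)%N -> (0 < D)%N ->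
  \sum_(D.+1 <= d < N.+1 | (g %| d)%N) hfac d / d%:R <=
  2 * expR 96 / D%:R * (sfac N.+1 g / g%:R) :> R.
Proof.
move=> g0 D0; have gR : 0 < g%:R :> R by rewrite ltr0n.
have DR : 0 < D%:R :> R by rewrite ltr0n.
apply: le_trans (_ : \sum_(1 <= d < N.+1 | (g %| d)%N)
    (if (D < d)%N then sfac N.+1 d / d%:R ^+ 2 else 0) <= _).
  have [DN|ND] := leqP D.+1 N.+1; last first.
    rewrite big_geq ?(ltnW ND) //; apply: sumr_ge0 => d _.
    by case: ifP => // _; rewrite divr_ge0 ?sfac_ge0 ?sqr_ge0.
  rewrite [X in _ <= X](big_cat_nat (isT : (1 <= D.+1)%N) DN) /= -[X in X <= _]add0r lerD //.
    by apply: sumr_ge0 => d _; case: ifP => // _; rewrite divr_ge0 ?sfac_ge0 ?sqr_ge0.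
  rewrite big_nat_cond [X in _ <= X]big_nat_cond; apply: ler_sum => d /andP[/andP[Dd dN] _].
  rewrite Dd expr2 invfM mulrA ler_wpM2r ?invr_ge0 // hfac_le // dN andbT.
  exact: leq_trans Dd.
rewrite sum_multiples //.
have yD : 0 < D%:R / g%:R :> R by rewrite divr_gt0.
apply: le_trans (_ : sfac N.+1 g / g%:R ^+ 2 *
   \sum_(1 <= m < (N %/ g).+1 | (D%:R / g%:R < m%:R :> R)%R) sfac N.+1 m ^+ 2 / m%:R ^+ 2 <= _).
  rewrite [X in _ * X]big_mkcond mulr_sumr; apply: ler_sum => m _.
  rewrite ltr_pdivrMr // -natrM ltr_nat mulnC.
  case: ifP => _; last by rewrite mulr0.
  rewrite [X in _ <= X]mulrACA [X in _ <= _ * X]mulrC natrM exprMn invfM.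
  rewrite ler_wpM2r ?mulr_ge0 ?invr_ge0 ?sqr_ge0 // mulnC.
  apply: le_trans (sfacM _ _ _) _; rewrite ler_wpM2l ?sfac_ge0 //.
  by rewrite expr2 ler_peMl ?sfac_ge0 ?sfac_ge1.
apply: le_trans (ler_wpM2l _ (@sum_sfac_sqr_tail R N.+1 (N %/ g) _ yD)) _.
  by rewrite divr_ge0 ?sfac_ge0 ?sqr_ge0.
rewrite le_eqVlt; apply/orP; left; apply/eqP; field.
by rewrite !gt_eqF.
Qed.

Lemma count_common_multiples_le d d' N : (0 < d)%N -> (0 < d')%N ->
  \sum_(1 <= k < N.+1 | (d %| k)%N && (d' %| k)%N) (1 : R) <=
  N%:R * (gcdn d d')%:R / (d%:R * d'%:R).
Proof.
move=> d0 d'0; have l0 : (0 < lcmn d d')%N by rewrite lcmn_gt0 d0.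
under eq_bigl do rewrite -dvdn_lcm.
rewrite sum_multiples // sumr_const_nat subn1 /=.
rewrite ler_pdivlMr; last by rewrite -natrM ltr0n muln_gt0 d0.
rewrite -!natrM ler_nat -(muln_lcm_gcd d d') mulnA leq_mul2r; apply/orP; right.
exact: leq_trunc_div.
Qed.

(* [gcd(d, d')] is at most the sum of the common divisors [g] of [d] and [d'], which
   separates the variables. *)
Lemma sum_hfac_tail_sqr_le D N : (0 < D <= N)%N ->
  \sum_(1 <= k < N.+1) (\sum_(D.+1 <= d < N.+1 | (d %| k)%N) hfac d) ^+ 2 <=
  4 * expR 96 ^+ 3 * (N%:R / D%:R ^+ 2) * (1 + ln N%:R) :> R.
Proof.
move=> /andP[D0 DN]; have DR : 0 < D%:R :> R by rewrite ltr0n.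
have N0 := leq_trans D0 DN.
have rng d : d \in index_iota D.+1 N.+1 -> (0 < d <= N)%N.
  by rewrite mem_index_iota ltnS => /andP[Dd ->]; rewrite (leq_trans _ Dd).
apply: le_trans (_ : \sum_(D.+1 <= d < N.+1) \sum_(D.+1 <= d' < N.+1)
   hfac d * hfac d' * (N%:R * (gcdn d d')%:R / (d%:R * d'%:R)) <= _).
  have -> : \sum_(1 <= k < N.+1) (\sum_(D.+1 <= d < N.+1 | (d %| k)%N) hfac d) ^+ 2 =
     \sum_(D.+1 <= d < N.+1) \sum_(D.+1 <= d' < N.+1) hfac d * hfac d' *
       \sum_(1 <= k < N.+1 | (d %| k)%N && (d' %| k)%N) (1 : R).
    under [RHS]eq_bigr do (under eq_bigr do rewrite big_mkcond mulr_sumr; rewrite exchange_big /=).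
    rewrite [RHS]exchange_big /=; apply: eq_bigr => k _.
    rewrite expr2 big_mkcond big_distrl /=; apply: eq_bigr => d _.
    rewrite big_distrr /=; apply: eq_bigr => d' _.
    by case: (d %| k)%N => /=; case: (d' %| k)%N; rewrite /= ?mulr1 ?mulr0 ?mul0r.
  rewrite big_seq [X in _ <= X]big_seq; apply: ler_sum => d /rng/andP[d0 _].
  rewrite big_seq [X in _ <= X]big_seq; apply: ler_sum => d' /rng/andP[d'0 _].
  apply: ler_wpM2l; first by rewrite mulr_ge0 ?hfac_ge0.
  exact: count_common_multiples_le.
apply: le_trans (_ : N%:R * \sum_(1 <= g < N.+1) g%:R *
    (\sum_(D.+1 <= d < N.+1 | (g %| d)%N) hfac d / d%:R) ^+ 2 <= _).
  have -> : N%:R * \sum_(1 <= g < N.+1) g%:R *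
    (\sum_(D.+1 <= d < N.+1 | (g %| d)%N) hfac d / d%:R) ^+ 2 =
     \sum_(D.+1 <= d < N.+1) \sum_(D.+1 <= d' < N.+1) hfac d * hfac d' *
        (N%:R * (\sum_(1 <= g < N.+1 | (g %| d)%N && (g %| d')%N) g%:R) / (d%:R * d'%:R)) :> R.
    rewrite mulr_sumr.
    under [RHS]eq_bigr => d _ do (under eq_bigr => d' _ do
      rewrite big_mkcond mulr_sumr mulr_suml mulr_sumr; rewrite exchange_big /=).
    rewrite [RHS]exchange_big /=; apply: eq_bigr => g _.
    rewrite expr2 big_mkcond big_distrl /= !mulr_sumr; apply: eq_bigr => d _.
    rewrite big_distrr /= !mulr_sumr; apply: eq_bigr => d' _.
    case: (g %| d)%N => /=; case: (g %| d')%N; rewrite /= ?mulr0 ?mul0r ?mulr0 //.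
    by rewrite invfM; ring.
  rewrite big_seq [X in _ <= X]big_seq; apply: ler_sum => d /rng/andP[d0 dN].
  rewrite big_seq [X in _ <= X]big_seq; apply: ler_sum => d' /rng/andP[d'0 d'N].
  apply: ler_wpM2l; first by rewrite mulr_ge0 ?hfac_ge0.
  apply: ler_wpM2r; first by rewrite invr_ge0 mulr_ge0.
  apply: ler_wpM2l => //.
  rewrite big_mkcond (bigD1_seq (gcdn d d')) ?mem_index_iota ?iota_uniq //=; last first.
    by rewrite gcdn_gt0 d0 /= ltnS (leq_trans _ dN) // dvdn_leq // dvdn_gcdl.
  rewrite dvdn_gcdl dvdn_gcdr /= lerDl; apply: sumr_ge0 => g _.
  by case: ifP.
(* The squared tail bound brings two factors [expR 96]; averaging sfac(g)^2/g supplies the third and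
   the logarithm. *)
apply: le_trans (_ : N%:R * \sum_(1 <= g < N.+1)
   (2 * expR 96 / D%:R) ^+ 2 * (sfac N.+1 g ^+ 2 / g%:R) <= _).
  rewrite ler_wpM2l //; apply: ler_sum_nat => g /andP[g0 gN].
  have gR : 0 < g%:R :> R by rewrite ltr0n.
  have T0 : 0 <= \sum_(D.+1 <= d < N.+1 | (g %| d)%N) hfac d / d%:R :> R.
    by apply: sumr_ge0 => d _; rewrite divr_ge0 ?hfac_ge0.
  have -> : (2 * expR 96 / D%:R) ^+ 2 * (sfac N.+1 g ^+ 2 / g%:R) =
     g%:R * (2 * expR 96 / D%:R * (sfac N.+1 g / g%:R)) ^+ 2 :> R.
    by field; rewrite !gt_eqF.
  rewrite ler_wpM2l // ler_pXn2r ?nnegrE ?sum_hfac_tail_multiples_le //.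
  by rewrite !mulr_ge0 ?invr_ge0 ?expR_ge0 ?sfac_ge0.
rewrite -mulr_sumr mulrA.
have hB : \sum_(1 <= g < N.+1) sfac N.+1 g ^+ 2 / g%:R <= expR 96 * (1 + ln N%:R) :> R.
  apply: le_trans (sum_sfac_sqr_div _ _) _; rewrite ler_wpM2l ?expR_ge0 //.
  by have /andP[] := @harmonic_sum_bounds R N N0.
apply: le_trans (ler_wpM2l _ hB) _; first by rewrite mulr_ge0 ?sqr_ge0.
rewrite le_eqVlt; apply/orP; left; apply/eqP; field.
by rewrite gt_eqF.
Qed.

(** With N = q L + r the error is exactly -(q L + r^2/q)/2, and r <= q. *)
Lemma sum_multiples_weight q N : (0 < q)%N ->
  `|\sum_(1 <= k < N.+1 | (q %| k)%N) (N%:R - k%:R) - N%:R ^+ 2 / (2 * q%:R)| <= N%:R / 2 :> R.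
Proof.
move=> q0; have qR : 0 < q%:R :> R by rewrite ltr0n.
rewrite sum_multiples //.
have S L : \sum_(1 <= m < L.+1) (N%:R - (q * m)%:R) =
    N%:R * L%:R - q%:R * (L%:R * (L%:R + 1) / 2) :> R.
  elim: L => [|L IH]; first by rewrite big_geq // mul0r mul0r !mulr0 subrr.
  by rewrite big_nat_recr //= IH natrM -natr1; field.
rewrite S; have := ltn_pmod N q0; set L := (N %/ q)%N; set r := (N %% q)%N => rq.
have NE : N%:R = q%:R * L%:R + r%:R :> R.
  by rewrite {1}(divn_eq N q) natrD natrM mulrC.
have rR : r%:R <= q%:R :> R by rewrite ler_nat ltnW.
have -> : N%:R * L%:R - q%:R * (L%:R * (L%:R + 1) / 2) - N%:R ^+ 2 / (2 * q%:R) =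
   - (q%:R * L%:R / 2 + r%:R * (r%:R / q%:R) / 2) :> R.
  by rewrite NE; field; rewrite gt_eqF.
have r1 : r%:R / q%:R <= 1 :> R by rewrite ler_pdivrMr // mul1r.
have r0 : 0 <= r%:R / q%:R :> R by rewrite divr_ge0.
have rr : 0 <= r%:R :> R by []. have L0 : 0 <= L%:R :> R by [].
rewrite normrN ger0_norm; last by rewrite addr_ge0 // divr_ge0 // mulr_ge0 // ltW.
by rewrite NE; move: (r%:R / q%:R) r0 r1 => t *; nra.
Qed.

(** The main term comes from [C2_sum_hfac_div]: the singular series has mean value 1. Replacing each
    sum over multiples of 2d by its main term costs at most (N/2) h(d), and these costs add up to
    O(N log N). *)
Lemma sum_singular_series : exists2 B : R, 0 <= B & forall N, (2 <= N)%N ->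
  `|\sum_(1 <= k < N.+1) singular_series R k%:Z * (N%:R - k%:R) - N%:R ^+ 2 / 2| <=
  N%:R * (ln N%:R + B).
Proof.
have [B B0 HB] := @C2_sum_hfac R 1 ltr01.
exists (B + (4 + 2 * expR 96)); first by rewrite addr_ge0 // addr_ge0 // mulr_ge0 // expR_ge0.
move=> N N2; have NR : 2 <= N%:R :> R by rewrite ler_nat.
have C0 := @C2_gt0 R.
have -> : \sum_(1 <= k < N.+1) singular_series R k%:Z * (N%:R - k%:R) =
   2 * C2 R * \sum_(1 <= d < N.+1) hfac d * \sum_(1 <= k < N.+1 | (2 * d %| k)%N) (N%:R - k%:R).
  under [in RHS]eq_bigr do rewrite big_mkcond mulr_sumr.
  rewrite exchange_big mulr_sumr /=; apply: eq_big_nat => k kN.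
  rewrite (@singular_series_eq R k N) // -mulrA mulr_suml; congr (_ * _).
  rewrite big_mkcond; apply: eq_bigr => d _; case: ifP => _; rewrite ?mulr0 //.
have /andP[m1 m2] := @C2_sum_hfac_div R N N2.
set S := \sum_(1 <= d < N.+1) hfac d / d%:R in m1 m2.
set A := \sum_(1 <= d < N.+1) _.
have hA : `|A - N%:R ^+ 2 / 4 * S| <= N%:R / 2 * \sum_(1 <= d < N.+1) hfac d.
  rewrite /A /S !mulr_sumr -sumrB; apply: le_trans (ler_norm_sum _ _ _) _.
  apply: ler_sum_nat => d /andP[d0 _].
  have -> : hfac d * (\sum_(1 <= k < N.+1 | (2 * d %| k)%N) (N%:R - k%:R)) -
     N%:R ^+ 2 / 4 * (hfac d / d%:R) =
     hfac d * (\sum_(1 <= k < N.+1 | (2 * d %| k)%N) (N%:R - k%:R) - N%:R ^+ 2 / (2 * (2 * d)%:R)) :> R.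
    by rewrite natrM; field; rewrite pnatr_eq0 -lt0n.
  rewrite normrM ger0_norm ?hfac_ge0 // mulrC ler_wpM2r ?hfac_ge0 //.
  by apply: sum_multiples_weight; rewrite muln_gt0.
have := HB N; rewrite mul1r => /ler_normlP[_ h2].
have l0 : 0 <= ln N%:R :> R by apply: ln_ge0; lra.
have k1 : `|2 * C2 R * A - N%:R ^+ 2 / 2 * (C2 R * S)| <= N%:R / 2 * (2 * ln N%:R + B).
  have -> : 2 * C2 R * A - N%:R ^+ 2 / 2 * (C2 R * S) = 2 * C2 R * (A - N%:R ^+ 2 / 4 * S) by field.
  rewrite normrM gtr0_norm ?mulr_gt0 //.
  apply: le_trans (ler_wpM2l _ hA) _; first by rewrite mulr_ge0 // ltW.
  by rewrite mulrCA ler_wpM2l //; lra.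
have N2R : N%:R ^+ 2 / 2 * ((4 + 2 * expR 96) / N%:R) = N%:R / 2 * (4 + 2 * expR 96) :> R.
  by field; apply/eqP; lra.
have N20 : 0 <= N%:R ^+ 2 / 2 :> R by rewrite divr_ge0 ?sqr_ge0.
have p1 := ler_wpM2l N20 m1; have p2 := ler_wpM2l N20 m2.
rewrite mulrBr N2R in p1; rewrite mulr1 in p1 p2.
have Ne : 0 <= N%:R * expR 96 :> R by rewrite mulr_ge0 // expR_ge0.
have NB : 0 <= N%:R * B by rewrite mulr_ge0.
move: k1; rewrite !ler_norml => /andP[k1 k2].
move: k1 k2 p1 p2; clear -Ne NB NR; move: (2 * C2 R * A) (N%:R ^+ 2 / 2 * (C2 R * S)) (N%:R ^+ 2 / 2) => a b c *.
by apply/andP; split; lra.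
Qed.

End SingularSeriesOnAverage.

(** * Trigonometric polynomials on the unit interval *)

Section UnitIntegral.
Context {R : realType}.
Implicit Types (f g : R -> R) (k l n N : nat).

Definition tcos k (x : R) : R := cos (2 * pi * (k%:R * x)).

Definition unit_integral f : R := \int[lebesgue_measure]_(x in `[0, 1]) f x.

Lemma continuous_integrable f : continuous f ->
  lebesgue_measure.-integrable `[0, 1] (EFin \o f).
Proof.
move=> cf; apply: continuous_compact_integrable; first exact: segment_compact.
exact: continuous_subspaceT.
Qed.

Lemma continuous_tcos k : continuous (tcos k).
Proof.
move=> x; apply: continuous_comp; last exact: continuous_cos.
apply: continuousM; first exact: cst_continuous.
by apply: continuousM; first exact: cst_continuous.
Qed.

Lemma continuous_add f g : continuous f -> continuous g -> continuous (fun x => f x + g x).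
Proof. by move=> cf cg x; apply: continuousD; [exact: cf|exact: cg]. Qed.

Lemma continuous_mul f g : continuous f -> continuous g -> continuous (fun x => f x * g x).
Proof. by move=> cf cg x; apply: continuousM; [exact: cf|exact: cg]. Qed.

Lemma continuous_const (c : R) : continuous (fun _ : R => c).
Proof. by move=> x; exact: cst_continuous. Qed.

Lemma continuous_sum (I : Type) (r : seq I) (P : pred I) (F : I -> R -> R) :
  (forall i, P i -> continuous (F i)) -> continuous (fun x => \sum_(i <- r | P i) F i x).
Proof.
move=> cF; elim: r => [|i r IH].
  by under eq_fun do rewrite big_nil; exact: continuous_const.
under eq_fun do rewrite big_cons.
case Pi: (P i) => //.
by apply: (continuous_add (cF i Pi) IH).
Qed.

Lemma unit_integralD f g : continuous f -> continuous g ->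
  unit_integral (fun x => f x + g x) = unit_integral f + unit_integral g.
Proof. by move=> cf cg; rewrite /unit_integral RintegralD //; exact: continuous_integrable. Qed.

Lemma unit_integralZ (c : R) f : continuous f ->
  unit_integral (fun x => c * f x) = c * unit_integral f.
Proof. by move=> cf; rewrite /unit_integral RintegralZl //; exact: continuous_integrable. Qed.

Lemma unit_integral_cst (c : R) : unit_integral (fun => c) = c.
Proof.
rewrite /unit_integral Rintegral_cst //= lebesgue_measure_itv /= lte_fin ltr01.
by rewrite oppr0 adde0 mulr1.
Qed.

Lemma unit_integral_sum (I : Type) (r : seq I) (P : pred I) (F : I -> R -> R) :
  (forall i, P i -> continuous (F i)) ->
  unit_integral (fun x => \sum_(i <- r | P i) F i x) =
  \sum_(i <- r | P i) unit_integral (F i).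
Proof.
move=> cF; elim: r => [|i r IH].
  by under eq_fun do rewrite big_nil; rewrite unit_integral_cst big_nil.
under eq_fun do rewrite big_cons; rewrite big_cons -IH.
by case: ifP => // Pi; rewrite unit_integralD //; [exact: cF|exact: continuous_sum].
Qed.

Lemma le_unit_integral f g : continuous f -> continuous g ->
  (forall x, f x <= g x) -> unit_integral f <= unit_integral g.
Proof.
by move=> cf cg fg; apply: le_Rintegral => //; exact: continuous_integrable.
Qed.

Lemma sin_2pi_nat k : sin (2 * pi * k%:R) = 0 :> R.
Proof.
elim: k => [|k IH]; first by rewrite mulr0 sin0.
rewrite -[k.+1%:R]natr1 mulrDr mulr1.
by rewrite [2 * pi in X in _ + X]mulr_natl sinD2pi.
Qed.

Lemma unit_integral_tcos k : unit_integral (tcos k) = (k == 0)%:R.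
Proof.
case: k => [|k].
  rewrite (_ : tcos 0 = fun=> 1) ?unit_integral_cst //.
  by apply/funext => x; rewrite /tcos mul0r mulr0 cos0.
set c : R := 2 * pi * k.+1%:R.
have c0 : c != 0 by rewrite !mulf_neq0 ?pnatr_eq0 // gt_eqF // pi_gt0.
have tE : tcos k.+1 = fun x => cos (c * x).
  by apply/funext => x; rewrite /tcos mulrA.
rewrite /unit_integral /Rintegral tE.
pose F := c^-1 \*: (@sin R \o (c \*: @id R)).
have dF (x : R) : is_derive x (1 : R) F (cos (c * x)).
  have d1 : is_derive x (1 : R) (c \*: @id R) (c *: (1 : R)) by apply: is_deriveZ.
  have d2 := is_derive1_comp (is_derive_sin (c * x)) d1.
  have d3 := is_deriveZ c^-1 d2.
  apply: is_derive_eq d3 _.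
  by rewrite /= /GRing.scale /= mulr1 mulrCA mulVf ?mulr1.
rewrite (@continuous_FTC2 R (fun x => cos (c * x)) F 0 1) //=.
- rewrite /F /= /GRing.scale /= mulr1 mulr0 sin0 mulr0 /c sin_2pi_nat mulr0.
  by rewrite subrr.
- rewrite -tE; apply: continuous_subspaceT; exact: continuous_tcos.
- have cF x : {for x, continuous F}.
    by apply/differentiable_continuous/derivable1_diffP; exact: ex_derive.
  split => [x _||].
  + exact: ex_derive.
  + exact/cvg_at_right_filter/cF.
  + exact/cvg_at_left_filter/cF.
- by move=> x _; rewrite derive1E derive_val.
Qed.

Lemma tcosM k l x : tcos k x * tcos l x =
  (tcos (k + l) x + tcos (maxn k l - minn k l) x) / 2.
Proof.
wlog lk : k l / (l <= k)%N => [H|].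
  by case/orP: (leq_total l k) => h; [|rewrite mulrC addnC maxnC minnC]; exact: H.
rewrite (maxn_idPl lk) (minn_idPr lk) /tcos natrD natrB //; move: (2 * pi) => c.
have -> : c * ((k%:R + l%:R) * x) = c * (k%:R * x) + c * (l%:R * x) by ring.
have -> : c * ((k%:R - l%:R) * x) = c * (k%:R * x) - c * (l%:R * x) by ring.
by rewrite cosD cosB; field.
Qed.

Lemma unit_integral_tcosM k l : (0 < k)%N ->
  unit_integral (fun x => tcos k x * tcos l x) = (k == l)%:R / 2.
Proof.
move=> k0.
rewrite (_ : (fun x => _) = fun x => 2^-1 * (tcos (k + l) x + tcos (maxn k l - minn k l) x)); last first.
  by apply/funext => x; rewrite tcosM mulrC.
rewrite unit_integralZ; last by apply: continuous_add; exact: continuous_tcos.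
rewrite unit_integralD; [|exact: continuous_tcos|exact: continuous_tcos].
rewrite !unit_integral_tcos addn_eq0 gtn_eqF //= add0r mulrC.
have -> // : (maxn k l - minn k l == 0)%N = (k == l) by lia.
Qed.

Lemma unit_integral_cos_poly_sqr N (w : nat -> R) :
  unit_integral (fun x => (2 * \sum_(1 <= k < N.+1) w k * tcos k x) ^+ 2) =
  2 * \sum_(1 <= k < N.+1) w k ^+ 2.
Proof.
have cM k l : continuous (fun x => tcos k x * tcos l x).
  by apply: continuous_mul; exact: continuous_tcos.
have cZ k l (c : R) : continuous (fun x => c * (tcos k x * tcos l x)).
  by apply: continuous_mul; [exact: continuous_const|exact: cM].
rewrite (_ : (fun x => _) = fun x => \sum_(1 <= k < N.+1) \sum_(1 <= l < N.+1)
     (4 * w k * w l) * (tcos k x * tcos l x)); last first.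
  apply/funext => x; rewrite exprMn [X in _ * X]expr2 big_distrl /= mulr_sumr; apply: eq_bigr => k _.
  by rewrite big_distrr /= mulr_sumr; apply: eq_bigr => l _; ring.
rewrite unit_integral_sum; last by move=> k _; apply: continuous_sum.
rewrite mulr_sumr; apply: eq_big_nat => k /andP[k0 kN].
rewrite unit_integral_sum //.
under eq_bigr do rewrite unit_integralZ // unit_integral_tcosM //.
rewrite (bigD1_seq k) ?mem_index_iota ?iota_uniq ?k0 //= eqxx big1 ?addr0.
  by rewrite mulr1n; field.
by move=> l lk; rewrite eq_sym (negbTE lk) mul0r mulr0.
Qed.

End UnitIntegral.

(** * Fejer kernels *)

Section FejerKernel.
Context {R : realType}.
Implicit Types (u x : R) (j k L M N q r : nat).

(** Unnormalised: (sin(pi L u)/sin(pi u))^2, with mean L and peak L^2. As a cosine polynomial it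
    makes sense at the integers, and its integral is the constant term. *)
Definition fejer L u : R := L%:R + 2 * \sum_(1 <= j < L) (L%:R - j%:R) * tcos j u.

Definition dirichlet L u : R := 1 + 2 * \sum_(1 <= j < L.+1) tcos j u.

Lemma fejerS L u : fejer L.+1 u = fejer L u + dirichlet L u.
Proof.
rewrite /fejer /dirichlet; case: L => [|L].
  by rewrite !big_geq // !mulr0 !addr0 add0r.
rewrite big_nat_recr //= [X in _ = _ + (1 + 2 * X)]big_nat_recr //=.
rewrite addrACA natr1 -mulrDr addrA -big_split /=; congr (_ + 2 * (_ + _)).
  apply: eq_bigr => j _; rewrite -[L.+2%:R]natr1; ring.
by rewrite -[L.+2%:R]natr1; ring.
Qed.

Lemma tcos_pi j u : tcos j u = cos (2 * (j%:R * (pi * u))).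
Proof. by rewrite /tcos -mulrA [pi * _]mulrCA. Qed.

Lemma tcosE j u : tcos j u = 1 - 2 * sin (j%:R * (pi * u)) ^+ 2.
Proof.
rewrite tcos_pi mulr_natl; move: (j%:R * _) => x.
by rewrite cos_mulr2n cos2sin2; ring.
Qed.

Lemma dirichlet_sin L u : dirichlet L u * sin (pi * u) = sin ((2 * L%:R + 1) * (pi * u)).
Proof.
rewrite /dirichlet; under eq_bigr do rewrite tcos_pi; move: (pi * u) => x.
elim: L => [|L IH]; first by rewrite big_geq // !mulr0 addr0 add0r !mul1r.
rewrite big_nat_recr //= mulrDr addrA mulrDl IH.
rewrite [2 * (L.+1%:R * x)]mulrA.
have -> : (2 * L%:R + 1) * x = 2 * L.+1%:R * x - x by rewrite -[L.+1%:R]natr1; ring.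
have -> : (2 * L.+1%:R + 1) * x = 2 * L.+1%:R * x + x by ring.
by rewrite sinB sinD; ring.
Qed.

(** The increment in [L] is a Dirichlet kernel, and sin(b)^2 - sin(a)^2 = sin(b+a) sin(b-a). The
    form free of division covers the integers too. *)
Lemma fejer_sin L u : fejer L u * sin (pi * u) ^+ 2 = sin (L%:R * (pi * u)) ^+ 2.
Proof.
elim: L => [|L IH]; first by rewrite /fejer big_geq // mulr0 addr0 mul0r mul0r sin0 expr0n.
rewrite fejerS mulrDl IH.
have -> : dirichlet L u * sin (pi * u) ^+ 2 = sin ((2 * L%:R + 1) * (pi * u)) * sin (pi * u).
  by rewrite expr2 mulrA dirichlet_sin.
move: (pi * u) => x.
have -> : (2 * L%:R + 1) * x = L%:R * x + L.+1%:R * x by rewrite -[L.+1%:R]natr1; ring.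
have -> : sin x = sin (L.+1%:R * x - L%:R * x) by congr sin; rewrite -[L.+1%:R]natr1; ring.
rewrite sinB sinD; set a := L%:R * x; set b := L.+1%:R * x.
rewrite (_ : (sin a * cos b + cos a * sin b) * (sin b * cos a - cos b * sin a) =
  sin b ^+ 2 * cos a ^+ 2 - sin a ^+ 2 * cos b ^+ 2); last by ring.
by rewrite !cos2sin2; ring.
Qed.

Lemma norm_sin_nat_mul j x : `|sin (j%:R * x)| <= j%:R * `|sin x|.
Proof.
elim: j => [|j IH]; first by rewrite !mul0r sin0 normr0.
rewrite -[j.+1%:R]natr1 !mulrDl !mul1r sinD; apply: le_trans (ler_normD _ _) _.
rewrite !normrM lerD //; first by apply: le_trans IH; rewrite ler_piMr // cos_max.
by rewrite ler_piMl // cos_max.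
Qed.

Lemma sum_fejer_coef L : 2 * \sum_(1 <= j < L) (L%:R - j%:R) = L%:R ^+ 2 - L%:R :> R.
Proof.
case: L => [|L]; first by rewrite big_geq // mulr0; ring.
rewrite big_add1 /= (_ : \sum_(0 <= i < L) (L.+1%:R - i.+1%:R) = \sum_(0 <= i < L) (L%:R - i%:R) :> R).
  elim: L => [|L IH]; first by rewrite big_geq // mulr0; ring.
  rewrite big_nat_recr //= (_ : \sum_(0 <= i < L) (L.+1%:R - i%:R) =
     \sum_(0 <= i < L) (L%:R - i%:R) + L%:R :> R).
    by rewrite !mulrDr IH -[L.+2%:R]natr1 -[L.+1%:R]natr1; ring.
  under eq_bigr do rewrite -natr1 addrAC.
  by rewrite big_split /= sumr_const_nat subn0.
by apply: eq_bigr => i _; rewrite -!natr1; ring.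
Qed.

(** From cos(2x) = 1 - 2 sin(x)^2 and |sin(j x)| <= j |sin x|. Closeness to an integer is measured
    by |sin(pi u)| itself, which avoids small-angle estimates. *)
Lemma fejer_ge L u :
  L%:R ^+ 2 * (1 - 2 * (L%:R * sin (pi * u)) ^+ 2) <= fejer L u.
Proof.
rewrite /fejer; set s := sin (pi * u).
have h : \sum_(1 <= j < L) (L%:R - j%:R) * (1 - 2 * (L%:R * s) ^+ 2) <=
    \sum_(1 <= j < L) (L%:R - j%:R) * tcos j u.
  apply: ler_sum_nat => j /andP[_ jL].
  rewrite ler_wpM2l ?subr_ge0 ?ler_nat 1?ltnW // tcosE lerD2l lerN2 ler_wpM2l //.
  rewrite -[X in X <= _]real_normK ?num_real // -[X in _ <= X]real_normK ?num_real //.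
  rewrite ler_pXn2r ?nnegrE //; apply: le_trans (norm_sin_nat_mul _ _) _.
  by rewrite normrM ger0_norm // ler_wpM2r // ler_nat ltnW.
rewrite -mulr_suml in h.
have hS := sum_fejer_coef L.
move: h hS; set S := \sum_(1 <= j < L) (L%:R - j%:R); set T := \sum_(1 <= j < L) (_ * _).
move: S T => S T h hS.
have : 2 * S * (1 - 2 * (L%:R * s) ^+ 2) <= 2 * T by rewrite -mulrA ler_wpM2l.
have : 0 <= L%:R * (L%:R * s) ^+ 2 by rewrite mulr_ge0 ?sqr_ge0.
rewrite hS; move: ((L%:R * s) ^+ 2) (L%:R : R) => t l *; nra.
Qed.

Lemma fejer_ge0 L u : 0 <= fejer L u.
Proof.
have [s0|s0] := eqVneq (sin (pi * u)) 0.
  apply: le_trans (fejer_ge _ _); rewrite s0 mulr0 expr0n mulr0 subr0 mulr1.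
  exact: sqr_ge0.
have s2 : 0 < sin (pi * u) ^+ 2 by rewrite exprn_even_gt0.
by rewrite -(pmulr_lge0 _ s2) fejer_sin sqr_ge0.
Qed.

Lemma fejer_ge_half L u : 2 * L%:R * `|sin (pi * u)| <= 1 ->
  L%:R ^+ 2 / 2 <= fejer L u.
Proof.
move=> h; apply: le_trans (fejer_ge _ _); rewrite ler_wpM2l ?sqr_ge0 //.
have : (L%:R * sin (pi * u)) ^+ 2 <= (2^-1) ^+ 2.
  rewrite -[X in X <= _]real_normK ?num_real // ler_pXn2r ?nnegrE //.
  by rewrite normrM ger0_norm //; lra.
lra.
Qed.

(** Times sin(pi u)^2 the j-th kernel becomes sin(pi j u)^2, which may vanish for one j but averages
    1/2. The deviation is governed by a Dirichlet kernel, at most 1/|sin(pi u)| <= 2L, and 4L terms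
    outweigh it. Thus 1/sin^2 is majorised by kernels with known integrals. *)
Lemma sum_fejer_ge L u : (0 < L)%N -> 1 <= 2 * L%:R * `|sin (pi * u)| ->
  L%:R <= sin (pi * u) ^+ 2 * \sum_(1 <= j < (4 * L).+1) fejer j u.
Proof.
move=> L0 h; have LR : 1 <= L%:R :> R by rewrite ler1n.
rewrite mulrC mulr_suml; set M := (4 * L)%N.
have -> : \sum_(1 <= j < M.+1) fejer j u * sin (pi * u) ^+ 2 =
    M%:R / 2 - (dirichlet M u - 1) / 4.
  rewrite /dirichlet [1 + _]addrC addrK.
  rewrite (_ : \sum_(1 <= j < M.+1) fejer j u * _ = \sum_(1 <= j < M.+1) (2^-1 - 2^-1 * tcos j u)); last first.
    by apply: eq_bigr => j _; rewrite fejer_sin tcosE; field.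
  by rewrite sumrB sumr_const_nat subn1 /= -mulr_sumr -[_ *+ M]mulr_natl; field.
have s0 : 0 < `|sin (pi * u)|.
  rewrite normr_gt0; apply/eqP => s0; move: h; rewrite s0 normr0; lra.
have : dirichlet M u <= 2 * L%:R.
  apply: le_trans (ler_norm _) _; rewrite -(ler_pM2r s0) -normrM dirichlet_sin.
  exact: le_trans (sin_max _) h.
have -> : M%:R = 4 * L%:R :> R by rewrite natrM.
lra.
Qed.

Definition kern q N u : R :=
  N%:R + 2 * \sum_(1 <= k < N.+1 | (q %| k)%N) (N%:R - k%:R) * tcos k u.

Lemma tcos_mul j q u : tcos (q * j) u = tcos j (q%:R * u).
Proof. by rewrite /tcos natrM [q%:R * _]mulrC -!mulrA. Qed.

(** If [q] divides [N] this is a multiple of a dilated Fejer kernel. In general it combines two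
    consecutive ones with nonnegative weights, by N - q m = (q - r)(L - m) + r (L + 1 - m) for N = q
    L + r. *)
Lemma kernE q N u : (0 < q)%N ->
  kern q N u = (q%:R - (N %% q)%:R) * fejer (N %/ q) (q%:R * u)
             + (N %% q)%:R * fejer (N %/ q).+1 (q%:R * u).
Proof.
move=> q0; rewrite /kern sum_multiples //; set v := q%:R * u.
have fE L : fejer L v = L%:R + 2 * \sum_(1 <= j < L.+1) (L%:R - j%:R) * tcos j v.
  rewrite /fejer; case: L => [|L]; first by rewrite !big_geq.
  by rewrite [in RHS]big_nat_recr //= subrr mul0r addr0.
rewrite fE /fejer; set L := (N %/ q)%N; set r := (N %% q)%N.
have NE : N%:R = q%:R * L%:R + r%:R :> R.
  by rewrite {1}(divn_eq N q) natrD natrM mulrC.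
rewrite (_ : \sum_(1 <= m < L.+1) (N%:R - (q * m)%:R) * tcos (q * m) u =
   (q%:R - r%:R) * (\sum_(1 <= j < L.+1) (L%:R - j%:R) * tcos j v) +
   r%:R * (\sum_(1 <= j < L.+1) (L.+1%:R - j%:R) * tcos j v)).
  move: (\sum_(_ <= _ < _) _) (\sum_(_ <= _ < _) _) => S T.
  by rewrite NE -[L.+1%:R]natr1; ring.
rewrite !mulr_sumr -big_split /=; apply: eq_bigr => m _.
rewrite tcos_mul -/v; move: (tcos m v) => t.
by rewrite NE natrM -[L.+1%:R]natr1; ring.
Qed.

Lemma kern_ge0 q N u : (0 < q)%N -> 0 <= kern q N u.
Proof.
move=> q0; rewrite kernE // addr_ge0 ?mulr_ge0 ?fejer_ge0 // subr_ge0 ler_nat.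
by rewrite ltnW // ltn_pmod.
Qed.

Lemma kern_sin q N u : (0 < q)%N -> kern q N u * sin (pi * (q%:R * u)) ^+ 2 <= q%:R.
Proof.
move=> q0; rewrite kernE // mulrDl -!mulrA !fejer_sin.
have r1 : (N %% q)%:R <= q%:R :> R by rewrite ler_nat ltnW // ltn_pmod.
have r0 : 0 <= (N %% q)%:R :> R by [].
have b y : sin y ^+ 2 <= 1 :> R by rewrite sin2cos2 gerBl sqr_ge0.
have b1 := b ((N %/ q)%:R * (pi * (q%:R * u))).
have b2 := b ((N %/ q).+1%:R * (pi * (q%:R * u))).
nra.
Qed.

(** By [sum_fejer_ge], sin^2 times the sum divided by [L] is at least 1; multiply by it and apply
    [kern_sin]. *)
Lemma kern_le_sum_fejer q N L u : (0 < q)%N -> (0 < L)%N ->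
  1 <= 2 * L%:R * `|sin (pi * (q%:R * u))| ->
  kern q N u <= q%:R / L%:R * \sum_(1 <= j < (4 * L).+1) fejer j (q%:R * u).
Proof.
move=> q0 L0 h; have LR : 0 < L%:R :> R by rewrite ltr0n.
have := sum_fejer_ge L0 h; have := kern_sin N u q0; have := kern_ge0 N u q0.
set K := kern _ _ _; set s := sin _ ^+ 2; set F := \sum_(_ <= _ < _) _ => K0 K1 F1.
have F0 : 0 <= F by apply: sumr_ge0 => j _; exact: fejer_ge0.
rewrite mulrAC ler_pdivlMr //; apply: le_trans (ler_wpM2l K0 F1) _.
by rewrite mulrA ler_wpM2r.
Qed.

End FejerKernel.

(** * Decomposition of the squared exponential sum *)

Section CircleMethod.
Context {R : realType}.
Implicit Types (u x : R) (d j k n L N D : nat).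

Local Notation lam := (von_mangoldt R).

Lemma mangoldt_expsumE N (u : R) : mangoldt_expsum N u =
  Complex (\sum_(1 <= n < N.+1) lam n * cos (2 * pi * (n%:R * u)))
          (\sum_(1 <= n < N.+1) lam n * sin (2 * pi * (n%:R * u))).
Proof.
rewrite /mangoldt_expsum; elim: N => [|N IH]; first by rewrite !big_geq.
do 3! rewrite (@big_nat_recr _ _ _ N.+1 1%N) //=.
rewrite IH /e.
by apply/eqP; rewrite eq_complex /= !mul0r subr0 addr0 !eqxx.
Qed.

Lemma normc_nneg (z : R[i]) : 0 <= Normc.normc z.
Proof. by case: z => a b; exact: sqrtr_ge0. Qed.

Lemma sum_sym_split N (G : nat -> nat -> R) : (forall n m, G n m = G m n) ->
  \sum_(1 <= n < N.+1) \sum_(1 <= m < N.+1) G n m =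
  \sum_(1 <= n < N.+1) G n n + 2 * \sum_(1 <= k < N.+1)
     \sum_(1 <= n < N.+1) \sum_(1 <= m < N.+1 | m%:Z - n%:Z == k%:Z) G n m.
Proof.
move=> Gs.
have -> : \sum_(1 <= k < N.+1) \sum_(1 <= n < N.+1)
     \sum_(1 <= m < N.+1 | m%:Z - n%:Z == k%:Z) G n m =
    \sum_(1 <= n < N.+1) \sum_(1 <= m < N.+1) (if (n < m)%N then G n m else 0).
  rewrite exchange_big /=; apply: eq_bigr => n _.
  under eq_bigr do rewrite big_mkcond; rewrite exchange_big /=.
  apply: eq_big_nat => m /andP[m0 mN]; case: ifP => nm.
    rewrite (bigD1_seq (m - n)%N) ?mem_index_iota ?iota_uniq //=; last by lia.
    rewrite ifT; last by apply/eqP; lia.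
    by rewrite big1 ?addr0 // => k /eqP kn; rewrite ifF //; apply/eqP; lia.
  by rewrite big_nat_cond big1 // => k /andP[/andP[k0 _] _]; rewrite ifF //; apply/eqP; lia.
rewrite mulr_natl mulr2n -[X in _ = _ + (_ + X)]exchange_big /=.
rewrite -!big_split /=; apply: eq_big_nat => n nN.
rewrite -big_split /= (bigD1_seq n) ?mem_index_iota ?iota_uniq //= [in RHS](bigD1_seq n) ?mem_index_iota ?iota_uniq //=.
rewrite ltnn !add0r; congr (_ + _); apply: eq_bigr => m mn.
by case: ltngtP mn => //; rewrite ?addr0 ?add0r // Gs.
Qed.

Definition mangoldt_sqr N : R := \sum_(1 <= n < N.+1) lam n ^+ 2.

Lemma normc_sqrE N (u : R) : Normc.normc (mangoldt_expsum N u) ^+ 2 =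
  mangoldt_sqr N + 2 * \sum_(1 <= k < N.+1) psi2 R N k%:Z * tcos k u.
Proof.
rewrite mangoldt_expsumE /Normc.normc sqr_sqrtr; last by rewrite addr_ge0 // sqr_ge0.
pose c n : R := cos (2 * pi * (n%:R * u)); pose s n : R := sin (2 * pi * (n%:R * u)).
transitivity (\sum_(1 <= n < N.+1) \sum_(1 <= m < N.+1) lam n * lam m * (c n * c m + s n * s m)).
  rewrite !expr2 !big_distrl -big_split /=; apply: eq_bigr => n _.
  by rewrite !big_distrr -big_split /=; apply: eq_bigr => m _; rewrite -/(c n) -/(c m) -/(s n) -/(s m); ring.
rewrite sum_sym_split; last by move=> n m; ring.
congr (_ + 2 * _).
  apply: eq_bigr => n _; rewrite -!expr2 /c /s cos2Dsin2 mulr1 //.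
apply: eq_bigr => k _; rewrite /psi2 mulr_suml; apply: eq_bigr => n _.
rewrite mulr_suml; apply: eq_bigr => m /eqP mnk; congr (_ * _).
rewrite /c /s /tcos; have -> : k%:R = m%:R - n%:R :> R.
  by rewrite !pmulrn -[RHS]rmorphB /= mnk.
by rewrite mulrBl mulrBr cosB; ring.
Qed.

Definition model_weight D k : R := 2 * C2 R * \sum_(1 <= d < D.+1 | (2 * d %| k)%N) hfac d.

Definition residual N D k : R := psi2 R N k%:Z - model_weight D k * (N%:R - k%:R).

(* [level], [arcs] and [residual_poly] are y, P and W of the header. *)
Definition residual_poly N D u : R := 2 * \sum_(1 <= k < N.+1) residual N D k * tcos k u.

Definition arcs N D u : R := \sum_(1 <= d < D.+1) 2 * C2 R * hfac d * kern (2 * d) N u.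

Definition level N D : R := mangoldt_sqr N - 2 * C2 R * (\sum_(1 <= d < D.+1) hfac d) * N%:R.

(** Each kernel in [arcs] brings along a constant term N that has no counterpart in the
    correlations; compensating for these lowers the constant term from V to [level]. *)
Lemma normc_sqr_decomp N D (u : R) : Normc.normc (mangoldt_expsum N u) ^+ 2 =
  level N D + arcs N D u + residual_poly N D u.
Proof.
have -> : arcs N D u = 2 * C2 R * (\sum_(1 <= d < D.+1) hfac d) * N%:R +
   2 * \sum_(1 <= k < N.+1) model_weight D k * (N%:R - k%:R) * tcos k u.
  rewrite /arcs /kern.
  under eq_bigr do rewrite mulrDr; rewrite big_split /=; congr (_ + _).
    by rewrite -mulr_suml -mulr_sumr.
  under eq_bigr do rewrite big_mkcond mulrCA mulr_sumr; rewrite -mulr_sumr exchange_big /=.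
  congr (2 * _); apply: eq_bigr => k _.
  rewrite /model_weight [in RHS]big_mkcond -!mulrA mulr_suml !mulr_sumr; apply: eq_bigr => d _.
  by case: ifP => _; rewrite ?mulr0 ?mul0r ?mulr0 // !mulrA.
rewrite normc_sqrE /level /residual_poly.
rewrite (_ : \sum_(1 <= k < N.+1) psi2 R N k * tcos k u =
  \sum_(1 <= k < N.+1) model_weight D k * (N%:R - k%:R) * tcos k u +
  \sum_(1 <= k < N.+1) residual N D k * tcos k u).
  by move: (2 * C2 R * _ * _) => a; ring.
by rewrite -big_split /=; apply: eq_bigr => k _; rewrite /residual; ring.
Qed.

Lemma twice_C2_hfac_ge0 d : 0 <= 2 * C2 R * hfac d.
Proof. by apply: mulr_ge0; [apply: mulr_ge0 => //; exact/ltW/C2_gt0|exact: hfac_ge0]. Qed.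

Lemma arcs_ge0 N D u : 0 <= arcs N D u.
Proof.
(* The sign is checked at every index, hence also at [d = 0], where [hfac] is 0 by division by
   zero. *)
apply: sumr_ge0 => -[|d] _; first by rewrite /hfac invr0 !(mulr0, mul0r).
by apply: mulr_ge0; [exact: twice_C2_hfac_ge0|exact: kern_ge0].
Qed.

(** [residual] is the error measured by [E] plus the terms d > D of the divisor sum, which are at
    most 2 N times a tail over d dividing k; (a+b)^2 <= 2 a^2 + 2 b^2 separates the two. *)
Lemma residual_sqr_le N D : (0 < D <= N)%N ->
  2 * \sum_(1 <= k < N.+1) residual N D k ^+ 2 <=
  4 * E R N + 64 * expR 96 ^+ 3 * N%:R ^+ 2 * (N%:R / D%:R ^+ 2) * (1 + ln N%:R).
Proof.
move=> DN; have /andP[D0 DN'] := DN.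
pose err k : R := psi2 R N k%:Z - singular_series R k%:Z * (N%:R - k%:R).
pose tail k : R := \sum_(D.+1 <= d < N.+1 | (d %| k)%N) hfac d.
have tail0 k : 0 <= tail k by apply: sumr_ge0 => d _; exact: hfac_ge0.
have C0 := @C2_gt0 R; have C1 := @C2_le1 R.
have hE : \sum_(1 <= k < N.+1) err k ^+ 2 <= E R N.
  by apply: ler_sum => k _; rewrite /= lerDl sqr_ge0.
have hk : \sum_(1 <= k < N.+1) residual N D k ^+ 2 <=
    \sum_(1 <= k < N.+1) (2 * err k ^+ 2 + 8 * N%:R ^+ 2 * tail k ^+ 2).
  apply: ler_sum_nat => k /andP[k0 kN].
  pose T := \sum_(D.+1 <= d < N.+1 | (2 * d %| k)%N) hfac d : R.
  have T0 : 0 <= T by apply: sumr_ge0 => d _; exact: hfac_ge0.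
  have Tt : T <= tail k.
    rewrite /T /tail big_mkcond [X in _ <= X]big_mkcond; apply: ler_sum => d _ /=.
    case: ifP => h; last by case: ifP => // _; exact: hfac_ge0.
    by rewrite (dvdn_trans _ h) // dvdn_mull.
  have -> : residual N D k = err k + 2 * C2 R * T * (N%:R - k%:R).
    rewrite /residual /err (@singular_series_eq R k N) ?k0 //.
    rewrite (big_cat_nat (isT : (1 <= D.+1)%N)) ?ltnS //= -/T /model_weight; ring.
  have b0 : 0 <= 2 * C2 R * T * (N%:R - k%:R).
    by rewrite !mulr_ge0 // ?(ltW C0) // subr_ge0 ler_nat.
  have b1 : 2 * C2 R * T * (N%:R - k%:R) <= 2 * N%:R * tail k.
    rewrite -!mulrA ler_wpM2l // mulrA [N%:R * _]mulrC ler_pM ?mulr_ge0 ?(ltW C0) ?subr_ge0 ?ler_nat //.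
      by apply: le_trans Tt; rewrite ler_piMl.
    by rewrite gerBl.
  have b2 : (2 * C2 R * T * (N%:R - k%:R)) ^+ 2 <= 4 * N%:R ^+ 2 * tail k ^+ 2.
    rewrite (_ : 4 * N%:R ^+ 2 * tail k ^+ 2 = (2 * N%:R * tail k) ^+ 2); last by ring.
    by rewrite ler_pXn2r // nnegrE // !mulr_ge0.
  move: b2; move: (2 * C2 R * T * _) (err k) => b a b2.
  by have := sqr_ge0 (a - b); nra.
have hT := @sum_hfac_tail_sqr_le R D N DN.
rewrite big_split /= -!mulr_sumr in hk.
have N20 : 0 <= 16 * N%:R ^+ 2 :> R by rewrite mulr_ge0 ?sqr_ge0.
have := ler_wpM2l N20 hT; rewrite -/(tail _) => hT'.
move: hk hE hT'; rewrite -/tail.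
move: (\sum_(1 <= k < N.+1) tail k ^+ 2) (\sum_(1 <= k < N.+1) err k ^+ 2) => a b hk hE hT'.
have -> : 64 * expR 96 ^+ 3 * N%:R ^+ 2 * (N%:R / D%:R ^+ 2) * (1 + ln N%:R) =
  16 * N%:R ^+ 2 * (4 * expR 96 ^+ 3 * (N%:R / D%:R ^+ 2) * (1 + ln N%:R)) :> R by ring.
lra.
Qed.

Lemma unit_integral_residual_sqr N D :
  unit_integral (fun u => residual_poly N D u ^+ 2) = 2 * \sum_(1 <= k < N.+1) residual N D k ^+ 2.
Proof. exact: unit_integral_cos_poly_sqr. Qed.

Lemma continuous_cos_poly n m (w : nat -> R) :
  continuous (fun u => \sum_(n <= k < m) w k * tcos k u).
Proof.
apply: continuous_sum => k _; apply: continuous_mul; first exact: continuous_const.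
exact: continuous_tcos.
Qed.

Lemma continuous_residual_poly N D : continuous (residual_poly N D).
Proof. by apply: continuous_mul; [exact: continuous_const|exact: continuous_cos_poly]. Qed.

Lemma unit_integral_cos_poly N (w : nat -> R) :
  unit_integral (fun u => \sum_(1 <= k < N.+1) w k * tcos k u) = 0.
Proof.
have c k : continuous (fun u => w k * tcos k u).
  by apply: continuous_mul; [exact: continuous_const|exact: continuous_tcos].
rewrite unit_integral_sum // big_nat_cond big1 // => k /andP[/andP[k0 _] _].
by rewrite unit_integralZ ?unit_integral_tcos ?gtn_eqF ?mulr0 //; exact: continuous_tcos.
Qed.

Lemma unit_integral_residual N D : unit_integral (residual_poly N D) = 0.
Proof.
by rewrite /residual_poly unit_integralZ ?unit_integral_cos_poly ?mulr0 //; exact: continuous_cos_poly.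
Qed.

Lemma continuous_normc_sqr N : continuous (fun u => Normc.normc (mangoldt_expsum N u) ^+ 2).
Proof.
under eq_fun do rewrite normc_sqrE.
apply: continuous_add; first exact: continuous_const.
by apply: continuous_mul; [exact: continuous_const|exact: continuous_cos_poly].
Qed.

Lemma unit_integral_normc_sqr N :
  unit_integral (fun u => Normc.normc (mangoldt_expsum N u) ^+ 2) = mangoldt_sqr N.
Proof.
under eq_fun do rewrite normc_sqrE.
have c := @continuous_cos_poly 1 N.+1 (fun k => psi2 R N k%:Z).
rewrite unit_integralD; first last.
- by apply: continuous_mul; [exact: continuous_const|exact: c].
- exact: continuous_const.
by rewrite unit_integral_cst unit_integralZ // unit_integral_cos_poly mulr0 addr0.
Qed.

Lemma continuous_normc N : continuous (fun u => Normc.normc (mangoldt_expsum N u) : R).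
Proof.
rewrite (_ : (fun u => _) = fun u => Num.sqrt (Normc.normc (mangoldt_expsum N u) ^+ 2)); last first.
  by apply/funext => u; rewrite sqrtr_sqr ger0_norm // normc_nneg.
move=> u; apply: continuous_comp; last exact: sqrt_continuous.
exact: continuous_normc_sqr.
Qed.

End CircleMethod.

(** * Bounds for the L^1 norm *)

Section L1Bounds.
Context {R : realType}.
Implicit Types (u x : R) (d i j k n q L N D : nat).

Lemma L1_norm_ge N D (Lam : R) : 0 < Lam -> level N D < Lam ->
  level N D - (2 * \sum_(1 <= k < N.+1) residual N D k ^+ 2) / (4 * (Lam - level N D)) <=
  Num.sqrt Lam * L1_norm R N.
Proof.
move=> L0 yL; set y := level N D; set a := Lam - y; have a0 : 0 < a by rewrite subr_gt0.
have cW := @continuous_residual_poly R N D.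
have cW2 : continuous (fun u => residual_poly N D u ^+ 2).
  by under eq_fun do rewrite expr2; exact: continuous_mul.
have cS := @continuous_normc R N.
have cR : continuous (fun u => - (4 * a)^-1 * residual_poly N D u ^+ 2).
  by apply: continuous_mul; [exact: continuous_const|exact: cW2].
have -> : y - (2 * \sum_(1 <= k < N.+1) residual N D k ^+ 2) / (4 * a) =
   unit_integral (fun u => (y + residual_poly N D u) + - (4 * a)^-1 * residual_poly N D u ^+ 2).
  rewrite unit_integralD //; last by apply: continuous_add; [exact: continuous_const|].
  rewrite unit_integralD //; last exact: continuous_const.
  by rewrite unit_integral_cst unit_integral_residual addr0 unit_integralZ // unit_integral_residual_sqr mulNr mulrC.
rewrite -unit_integralZ //; apply: le_unit_integral => [||u].
- by apply: continuous_add => //; apply: continuous_add; [exact: continuous_const|].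
- by apply: continuous_mul; [exact: continuous_const|].
have := normc_sqr_decomp N D u; have := arcs_ge0 N D u; have := normc_nneg (mangoldt_expsum N u).
set s := Normc.normc _; set P := arcs _ _ _; set W := residual_poly _ _ _; rewrite -/y => s0 P0 sE.
have r0 : 0 <= Num.sqrt Lam by exact: sqrtr_ge0.
have rE : Num.sqrt Lam ^+ 2 = Lam by rewrite sqr_sqrtr // ltW.
have q0 : 0 <= (4 * a)^-1 * W ^+ 2 by rewrite mulr_ge0 ?sqr_ge0 // invr_ge0 mulr_ge0 // ltW.
rewrite mulNr.
(* Below the threshold, sqrt(Lam) s >= s^2 >= y + W since P >= 0. Above it, sqrt(Lam) s >= Lam, and
   W - W^2/(4a) <= a = Lam - y by completing the square. *)
have [sr|rs] := leP s (Num.sqrt Lam); first by nra.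
have h : W - (4 * a)^-1 * W ^+ 2 <= a.
  rewrite -subr_ge0.
  have -> : a - (W - (4 * a)^-1 * W ^+ 2) = (2 * a - W) ^+ 2 / (4 * a) by field; rewrite gt_eqF.
  by rewrite divr_ge0 ?sqr_ge0 // mulr_ge0 // ltW.
have : Lam <= Num.sqrt Lam * s by nra.
move: h; rewrite /a; lra.
Qed.

Lemma fejer_dilE j q u : fejer j (q%:R * u) =
  j%:R + 2 * \sum_(1 <= i < j) (j%:R - i%:R) * tcos (q * i) u.
Proof. by rewrite /fejer; congr (_ + 2 * _); apply: eq_bigr => i _; rewrite tcos_mul. Qed.

Lemma continuous_fejer_dil j q : continuous (fun u => fejer j (q%:R * u) : R).
Proof.
under eq_fun do rewrite fejer_dilE.
apply: continuous_add; first exact: continuous_const.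
apply: continuous_mul; first exact: continuous_const.
apply: continuous_sum => i _; apply: continuous_mul; first exact: continuous_const.
exact: continuous_tcos.
Qed.

Lemma unit_integral_fejer_dil j q : (0 < q)%N ->
  unit_integral (fun u => fejer j (q%:R * u)) = j%:R :> R.
Proof.
move=> q0; under eq_fun do rewrite fejer_dilE.
have c i : continuous (fun u => (j%:R - i%:R) * tcos (q * i) u : R).
  by apply: continuous_mul; [exact: continuous_const|exact: continuous_tcos].
have cs : continuous (fun u => \sum_(1 <= i < j) (j%:R - i%:R) * tcos (q * i) u : R).
  by apply: continuous_sum => i _.
rewrite unit_integralD; first last.
- by apply: continuous_mul; [exact: continuous_const|exact: cs].
- exact: continuous_const.
rewrite unit_integral_cst unit_integralZ // unit_integral_sum //.
rewrite big_nat_cond big1 ?mulr0 ?addr0 // => i /andP[/andP[i0 _] _].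
rewrite unit_integralZ; last exact: continuous_tcos.
by rewrite unit_integral_tcos gtn_eqF ?mulr0 // muln_gt0 q0.
Qed.

(* Both are sums of Fejer kernels: [near_rational] dominates the indicator function of
   the exceptional set around the fractions, [arcs_majorant] dominates [arcs] off it. *)
Definition near_rational D L u : R :=
  \sum_(1 <= d < D.+1) 2 / L%:R ^+ 2 * fejer L ((2 * d)%:R * u).

Definition arcs_majorant D L u : R :=
  \sum_(1 <= d < D.+1) 2 * C2 R * hfac d *
    ((2 * d)%:R / L%:R * \sum_(1 <= j < (4 * L).+1) fejer j ((2 * d)%:R * u)).

Lemma near_rational_term_ge0 d L u : 0 <= 2 / L%:R ^+ 2 * fejer L ((2 * d)%:R * u) :> R.
Proof. by rewrite mulr_ge0 ?fejer_ge0 // divr_ge0 ?sqr_ge0. Qed.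

Lemma near_rational_ge0 D L u : 0 <= near_rational D L u.
Proof. by apply: sumr_ge0 => d _; exact: near_rational_term_ge0. Qed.

Lemma arcs_majorant_ge0 D L u : 0 <= arcs_majorant D L u.
Proof.
apply: sumr_ge0 => d _.
apply: mulr_ge0; first exact: twice_C2_hfac_ge0.
apply: mulr_ge0; first exact: divr_ge0.
by apply: sumr_ge0 => j _; exact: fejer_ge0.
Qed.

(** The threshold 1/(2L) for |sin(2 pi d u)| is common to all d. If one d falls below it, its kernel
    alone contributes 1 to [near_rational]; otherwise [arcs] is majorised term by term. *)
Lemma near_rational_or_arcs_le N D L u : (0 < L)%N ->
  1 <= near_rational D L u \/ arcs N D u <= arcs_majorant D L u.
Proof.
move=> L0; have LR : 0 < L%:R :> R by rewrite ltr0n.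
case: (boolP (has (fun d => 2 * L%:R * `|sin (pi * ((2 * d)%:R * u))| <= 1) (index_iota 1 D.+1))).
  move=> /hasP[d dD h]; left.
  rewrite /near_rational (bigD1_seq d) ?iota_uniq //=.
  apply: le_trans (_ : 2 / L%:R ^+ 2 * fejer L ((2 * d)%:R * u) <= _); last first.
    by rewrite lerDl; apply: sumr_ge0 => i _; exact: near_rational_term_ge0.
  apply: le_trans (ler_wpM2l _ (fejer_ge_half h)); last by rewrite divr_ge0 ?sqr_ge0.
  by rewrite le_eqVlt; apply/orP; left; apply/eqP; field; rewrite gt_eqF.
move=> /hasPn H; right; rewrite /arcs /arcs_majorant big_seq [X in _ <= X]big_seq.
apply: ler_sum => d dD; have := H d dD; rewrite -ltNge => h.
apply: ler_wpM2l; first exact: twice_C2_hfac_ge0.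
apply: kern_le_sum_fejer => //; last exact: ltW.
by move: dD; rewrite mem_index_iota muln_gt0 => /andP[].
Qed.

Lemma continuous_near_rational D L : continuous (near_rational D L).
Proof.
apply: continuous_sum => d _; apply: continuous_mul; first exact: continuous_const.
exact: continuous_fejer_dil.
Qed.

Lemma continuous_majorant_term d L : continuous (fun u =>
  (2 * d)%:R / L%:R * \sum_(1 <= j < (4 * L).+1) fejer j ((2 * d)%:R * u) : R).
Proof.
apply: continuous_mul; first exact: continuous_const.
by apply: continuous_sum => j _; exact: continuous_fejer_dil.
Qed.

Lemma continuous_arcs_majorant D L : continuous (arcs_majorant D L).
Proof.
apply: continuous_sum => d _; apply: continuous_mul; first exact: continuous_const.
exact: continuous_majorant_term.
Qed.

Lemma unit_integral_near_rational D L : (0 < L)%N ->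
  unit_integral (near_rational D L) = 2 * D%:R / L%:R.
Proof.
move=> L0; have LR : L%:R != 0 :> R by rewrite pnatr_eq0 -lt0n.
rewrite /near_rational unit_integral_sum; last first.
  move=> d _; apply: continuous_mul; first exact: continuous_const.
  exact: continuous_fejer_dil.
transitivity (\sum_(1 <= d < D.+1) (2 / L%:R : R)).
  apply: eq_big_nat => d /andP[d0 _].
  rewrite unit_integralZ; last exact: continuous_fejer_dil.
  by rewrite unit_integral_fejer_dil ?muln_gt0 //; field.
by rewrite sumr_const_nat subn1 /= -[_ *+ D]mulr_natl mulrCA mulrA.
Qed.

Lemma sum_nat_le L : (0 < L)%N -> \sum_(1 <= j < (4 * L).+1) j%:R <= 10 * L%:R ^+ 2 :> R.
Proof.
move=> L0; have S M : \sum_(1 <= j < M.+1) j%:R = M%:R * (M%:R + 1) / 2 :> R.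
  elim: M => [|M IH]; first by rewrite big_geq // !mul0r.
  by rewrite big_nat_recr //= IH -[M.+1%:R]natr1; field.
rewrite S natrM; have : 1 <= L%:R :> R by rewrite ler1n.
nra.
Qed.

(** For given d the kernels integrate to at most 10 L^2 in total, so d contributes at most 2 h(d)
    (2d/L) 10 L^2 = 40 L h(d) d. *)
Lemma unit_integral_arcs_majorant D L : (0 < D)%N -> (0 < L)%N ->
  unit_integral (arcs_majorant D L) <= 40 * expR 96 * L%:R * D%:R.
Proof.
move=> D0 L0; have LR : 0 < L%:R :> R by rewrite ltr0n.
have C0 := @C2_gt0 R; have C1 := @C2_le1 R.
rewrite /arcs_majorant unit_integral_sum; last first.
  move=> d _; apply: continuous_mul; first exact: continuous_const.
  exact: continuous_majorant_term.
apply: le_trans (_ : \sum_(1 <= d < D.+1) 40 * L%:R * (hfac d * d%:R) <= _); last first.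
  rewrite -mulr_sumr; apply: le_trans (ler_wpM2l _ (sum_hfac_mul_le D0)) _.
    by rewrite mulr_ge0.
  by rewrite le_eqVlt; apply/orP; left; apply/eqP; ring.
apply: ler_sum_nat => d /andP[d0 _].
rewrite unit_integralZ; last exact: continuous_majorant_term.
rewrite unit_integralZ; last by apply: continuous_sum => j _; exact: continuous_fejer_dil.
rewrite unit_integral_sum; last by move=> j _; exact: continuous_fejer_dil.
rewrite (_ : \sum_(1 <= j < (4 * L).+1) _ = \sum_(1 <= j < (4 * L).+1) j%:R); last first.
  by apply: eq_bigr => j _; rewrite unit_integral_fejer_dil // muln_gt0.
have h0 := @hfac_ge0 R d.
apply: le_trans (_ : 2 * 1 * hfac d * ((2 * d)%:R / L%:R * (10 * L%:R ^+ 2)) <= _).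
  apply: ler_pM.
  - exact: twice_C2_hfac_ge0.
  - by apply: mulr_ge0; [exact: divr_ge0|exact: sumr_ge0].
  - by rewrite ler_wpM2r // ler_wpM2l.
  - by rewrite ler_wpM2l ?sum_nat_le // divr_ge0.
by rewrite natrM le_eqVlt; apply/orP; left; apply/eqP; field; rewrite gt_eqF.
Qed.

(** With r = sqrt y, expanding (s - r)^2 >= 0 gives s <= r + (P + W)/(2r); on the exceptional set s
    <= (lam s^2 + 1/lam)/2 is used instead. Cauchy-Schwarz takes this parametrised form, with [mu]
    for W and [lam] for s, so that the pointwise majorant is a trigonometric polynomial. *)
Lemma L1_norm_le N D L (mu lam : R) : (0 < D)%N -> (0 < L)%N ->
  0 < (level N D : R) -> 0 < mu -> 0 < lam ->
  L1_norm R N <= Num.sqrt (level N D : R) +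
    (40 * @expR R 96 * L%:R * D%:R +
     2^-1 * (mu * (2 * \sum_(1 <= k < N.+1) (residual N D k : R) ^+ 2) + mu^-1)) /
      (2 * Num.sqrt (level N D : R)) +
    2^-1 * (lam * mangoldt_sqr N + lam^-1 * (2 * D%:R / L%:R)).
Proof.
move=> D0 L0 y0 m0 l0; set y := level N D in y0 *; set r := Num.sqrt y.
have r0 : 0 < r by rewrite sqrtr_gt0.
have rE : r ^+ 2 = y by rewrite sqr_sqrtr // ltW.
have cW2 : continuous (fun u => residual_poly N D u ^+ 2).
  by under eq_fun do rewrite expr2; apply: continuous_mul; exact: continuous_residual_poly.
pose F1 u : R := (2 * r)^-1 * arcs_majorant D L u.
pose F2 u : R := mu / (4 * r) * residual_poly N D u ^+ 2.
pose F3 u : R := lam / 2 * Normc.normc (mangoldt_expsum N u) ^+ 2.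
pose F4 u : R := lam^-1 / 2 * near_rational D L u.
have c1 : continuous F1.
  by apply: continuous_mul; [exact: continuous_const|exact: continuous_arcs_majorant].
have c2 : continuous F2 by apply: continuous_mul; [exact: continuous_const|exact: cW2].
have c3 : continuous F3.
  by apply: continuous_mul; [exact: continuous_const|exact: continuous_normc_sqr].
have c4 : continuous F4.
  by apply: continuous_mul; [exact: continuous_const|exact: continuous_near_rational].
pose c0 : R := r + (4 * r * mu)^-1.
have c12 := continuous_add c1 c2; have c123 := continuous_add c12 c3.
have c1234 := continuous_add c123 c4.
have cc : continuous (fun u => c0 + (F1 u + F2 u + F3 u + F4 u)).
  by apply: continuous_add; [exact: continuous_const|exact: c1234].
apply: le_trans (_ : unit_integral (fun u => c0 + (F1 u + F2 u + F3 u + F4 u)) <= _).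
  apply: le_unit_integral => // [|u]; first exact: continuous_normc.
  have := normc_sqr_decomp N D u; have := normc_nneg (mangoldt_expsum N u).
  have := arcs_majorant_ge0 D L u; have := near_rational_ge0 D L u.
  have := @near_rational_or_arcs_le N D L u L0.
  rewrite /F1 /F2 /F3 /F4 /c0 -/y.
  set s := Normc.normc _; set P := arcs _ _ _; set G := arcs_majorant _ _ _.
  set X := near_rational _ _ _; set W := residual_poly _ _ _ => XP X0 G0 s0 sE.
  have t1 : 0 <= (2 * r)^-1 * G by rewrite mulr_ge0 // invr_ge0 mulr_ge0 // ltW.
  have t2 : 0 <= mu / (4 * r) * W ^+ 2.
    by rewrite mulr_ge0 ?sqr_ge0 // divr_ge0 ?(ltW m0) // mulr_ge0 // ltW.
  have t3 : 0 <= lam / 2 * s ^+ 2 by rewrite mulr_ge0 ?sqr_ge0 // divr_ge0 // ltW.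
  have t4 : 0 <= lam^-1 / 2 * X by rewrite mulr_ge0 // divr_ge0 // invr_ge0 ltW.
  have t5 : 0 <= (4 * r * mu)^-1 by rewrite invr_ge0 !mulr_ge0 // ltW.
  case: XP => [X1|PG].
    have h1 : lam^-1 / 2 <= lam^-1 / 2 * X.
      by rewrite ler_peMr // divr_ge0 // invr_ge0 ltW.
    have h2 : 0 <= lam / 2 * s ^+ 2 + lam^-1 / 2 - s.
      have -> : lam / 2 * s ^+ 2 + lam^-1 / 2 - s = (lam * s - 1) ^+ 2 / (2 * lam).
        by field; rewrite gt_eqF.
      by rewrite divr_ge0 ?sqr_ge0 // mulr_ge0 // ltW.
    lra.
  have h1 : 0 <= mu / (4 * r) * W ^+ 2 + (4 * r * mu)^-1 - (2 * r)^-1 * W.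
    have -> : mu / (4 * r) * W ^+ 2 + (4 * r * mu)^-1 - (2 * r)^-1 * W =
       (mu * W - 1) ^+ 2 / (4 * r * mu) by field; rewrite !gt_eqF.
    by rewrite divr_ge0 ?sqr_ge0 // !mulr_ge0 // ltW.
  have h2 : s <= r + (2 * r)^-1 * G + (2 * r)^-1 * W.
    have : 0 <= (s - r) ^+ 2 / (2 * r) by rewrite divr_ge0 ?sqr_ge0 // mulr_ge0 // ltW.
    have -> : (s - r) ^+ 2 / (2 * r) = (2 * r)^-1 * (s ^+ 2) + r / 2 - s by field; rewrite gt_eqF.
    have : (2 * r)^-1 * (s ^+ 2) <= (2 * r)^-1 * (r ^+ 2 + G + W).
      by rewrite ler_wpM2l ?invr_ge0 ?mulr_ge0 ?(ltW r0) // sE rE; lra.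
    have -> : (2 * r)^-1 * (r ^+ 2 + G + W) = r / 2 + (2 * r)^-1 * G + (2 * r)^-1 * W.
      by field; rewrite gt_eqF.
    lra.
  lra.
rewrite (unit_integralD _ c1234); last exact: continuous_const.
rewrite (unit_integralD c123 c4) (unit_integralD c12 c3) (unit_integralD c1 c2).
rewrite unit_integral_cst (_ : unit_integral F1 = (2 * r)^-1 * unit_integral (arcs_majorant D L)); last first.
  exact: unit_integralZ _ (@continuous_arcs_majorant D L).
rewrite (unit_integralZ _ cW2) unit_integral_residual_sqr.
rewrite (unit_integralZ _ (@continuous_normc_sqr R N)) unit_integral_normc_sqr.
rewrite (unit_integralZ _ (@continuous_near_rational D L)) unit_integral_near_rational //.
have h : (2 * r)^-1 * unit_integral (arcs_majorant D L) <=
   (2 * r)^-1 * (40 * expR 96 * L%:R * D%:R).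
  by rewrite ler_wpM2l ?unit_integral_arcs_majorant // invr_ge0 mulr_ge0 // ltW.
set T := \sum_(_ <= _ < _) _; move: h; set U := (2 * r)^-1 * unit_integral _.
set A := 40 * _ * _ * _; set B := 2 * D%:R / L%:R => h.
have -> : (A + 2^-1 * (mu * (2 * T) + mu^-1)) / (2 * r) =
   (2 * r)^-1 * A + mu / (4 * r) * (2 * T) + (4 * r * mu)^-1 by field; rewrite !gt_eqF.
rewrite /c0; lra.
Qed.

End L1Bounds.

(** * The prime number theorem from pair correlations *)

Section Chebyshev.
Context {R : realType}.
Implicit Types (d k l m n p N B : nat).

Local Notation lam := (von_mangoldt R).

Definition chebyshev_psi N : R := \sum_(1 <= n < N.+1) lam n.

Lemma von_mangoldtP n : lam n = 0 \/
  exists p m, [/\ prime p, (0 < m)%N, n = (p ^ m)%N & lam n = ln p%:R].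
Proof.
rewrite /von_mangoldt; case E : (primes n) => [|p [|q s]]; [by left| |by left].
right; have pn : p \in primes n by rewrite E mem_head.
have pp : prime p by move: pn; rewrite mem_primes => /andP[].
have n0 : (0 < n)%N by move: pn; rewrite mem_primes => /and3P[].
have : p.-nat n by rewrite /pnat n0 E /= inE eqxx.
move=> /p_natP[m nE]; exists p, m; split=> //.
by case: m nE => // nE; move: pn; rewrite nE expn0.
Qed.

Lemma von_mangoldt_ge0 n : 0 <= lam n.
Proof.
case: (von_mangoldtP n) => [->|[p [m [pp _ _ ->]]]] //.
by rewrite ln_ge0 // ler1n prime_gt0.
Qed.

Lemma von_mangoldt_le n N : (0 < n <= N)%N -> lam n <= ln N%:R.
Proof.
move=> /andP[n0 nN]; have N0 := leq_trans n0 nN.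
case: (von_mangoldtP n) => [->|[p [m [pp m0 nE ->]]]]; first by rewrite ln_ge0 // ler1n.
rewrite ler_ln ?posrE ?ltr0n ?(prime_gt0 pp) // ler_nat (leq_trans _ nN) // nE.
by rewrite -{1}(expn1 p) leq_exp2l // prime_gt1.
Qed.

Lemma chebyshev_psi_le N : chebyshev_psi N <= N%:R * ln N%:R.
Proof.
apply: le_trans (_ : \sum_(1 <= n < N.+1) ln N%:R <= _).
  by apply: ler_sum_nat => n nN; exact: von_mangoldt_le.
by rewrite sumr_const_nat subn1 /= mulr_natl.
Qed.

Lemma mangoldt_sqr_le N : mangoldt_sqr N <= ln N%:R * chebyshev_psi N.
Proof.
rewrite mulr_sumr; apply: ler_sum_nat => n nN.
by rewrite expr2 ler_wpM2r ?von_mangoldt_ge0 ?von_mangoldt_le.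
Qed.

(* At most [B * l] integers up to [N < 2 ^ (l + 1)] are powers of primes [p <= B]. *)
Lemma mangoldt_sqr_ge N B l : (0 < B)%N -> (N < 2 ^ l.+1)%N ->
  ln B%:R * (chebyshev_psi N - ln N%:R * (B * l)%:R) <= mangoldt_sqr N.
Proof.
move=> B0 Nl; have lB : 0 <= ln B%:R :> R by rewrite ln_ge0 // ler1n.
(* [P n] counts representations of n as p^m with p <= B and m <= l. Allowing composite p is
   harmless: what matters is the total B l and P >= 1 at powers of small primes. *)
pose P n : R := \sum_(1 <= p < B.+1) \sum_(1 <= m < l.+1) (n == p ^ m)%N%:R.
have P0 n : 0 <= P n by apply: sumr_ge0 => p _; exact: sumr_ge0.
have sP : \sum_(1 <= n < N.+1) P n <= (B * l)%:R.
  rewrite /P exchange_big /=.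
  apply: le_trans (_ : \sum_(1 <= p < B.+1) l%:R <= _); last first.
    by rewrite sumr_const_nat subn1 /= -[l%:R *+ B]mulr_natl natrM.
  apply: ler_sum => p _; rewrite exchange_big /=.
  apply: le_trans (_ : \sum_(1 <= m < l.+1) 1 <= _); last by rewrite sumr_const_nat subn1.
  apply: ler_sum => m _; have [h|h] := boolP (p ^ m \in index_iota 1 N.+1)%N.
    by rewrite (bigD1_seq (p ^ m)%N) ?iota_uniq //= eqxx big1 ?addr0 // => i /negbTE ->.
  rewrite big_seq big1 // => i iN; case: eqP => // iE.
  by rewrite iE (negbTE h) in iN.
apply: le_trans (_ : ln B%:R * \sum_(1 <= n < N.+1) (lam n - ln N%:R * P n) <= _).
  rewrite ler_wpM2l // sumrB -mulr_sumr lerD2l lerN2 ler_wpM2l //.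
  by case: (N) => [|k]; [rewrite ln0|rewrite ln_ge0 // ler1n].
rewrite mulr_sumr; apply: ler_sum_nat => n nN; have /andP[n0 nN'] := nN; rewrite ltnS in nN'.
have lN : 0 <= ln N%:R :> R by rewrite ln_ge0 // ler1n (leq_trans n0).
have lam0 := von_mangoldt_ge0 n; have lamN := @von_mangoldt_le n N nN.
have lP : 0 <= ln N%:R * P n by rewrite mulr_ge0.
case: (von_mangoldtP n) => [E|[p [m [pp m0 nE lE]]]].
  by rewrite E expr0n /= sub0r mulrN oppr_le0 mulr_ge0.
have [pB|Bp] := leqP p B; last first.
  have h : ln B%:R <= lam n.
    by rewrite lE ler_ln ?posrE ?ltr0n ?(prime_gt0 pp) // ler_nat ltnW.
  by rewrite expr2; nra.
have ml : (m <= l)%N.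
  rewrite -ltnS -(@ltn_exp2l 2) //; apply: leq_ltn_trans Nl.
  by apply: leq_trans nN'; rewrite nE leq_exp2r // prime_gt1.
have P1 : 1 <= P n.
  rewrite /P (bigD1_seq p) ?mem_index_iota ?iota_uniq ?prime_gt0 //=.
  rewrite (bigD1_seq m) ?mem_index_iota ?iota_uniq ?m0 //= -nE eqxx -addrA lerDl addr_ge0 //.
    by apply: sumr_ge0.
  by apply: sumr_ge0 => i _; apply: sumr_ge0.
apply: le_trans (sqr_ge0 _); rewrite mulr_ge0_le0 // subr_le0 (le_trans lamN) //.
by rewrite ler_peMr.
Qed.

Lemma near_ln_ge (x : R) : \forall N \near \oo, x <= ln N%:R.
Proof.
exists (Num.bound (expR x)) => // N /= hN.
have e0 : 0 < expR x := expR_gt0 x.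
have : expR x < N%:R by apply: lt_le_trans (archi_boundP (ltW e0)) _; rewrite ler_nat.
by move=> h; rewrite -ler_expR lnK ?posrE ?(lt_trans e0) //; exact: ltW.
Qed.

Lemma near_nat_ge (x : R) : \forall N \near \oo, x <= N%:R.
Proof.
exists (Num.bound `|x|) => // N /= hN.
apply: le_trans (ler_norm _) _; apply: le_trans (ltW (archi_boundP (normr_ge0 _))) _.
by rewrite ler_nat.
Qed.

Lemma ln_le_sqrt (x : R) : 0 < x -> ln x <= 2 * Num.sqrt x.
Proof.
move=> x0; have s0 : 0 < Num.sqrt x by rewrite sqrtr_gt0.
rewrite -{1}(sqr_sqrtr (ltW x0)) lnXn // mulr2n; have := ln_sublinear s0; lra.
Qed.

(** 11 is where the bound starts to persist: 12^3 = 1728 <= 2048, whereas 11^3 = 1331 > 1024. *)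
Lemma cube_le_exp2 l : (11 <= l)%N -> ((l.+1) ^ 3 <= 2 ^ l)%N.
Proof.
elim: l => // l IH; rewrite leq_eqVlt => /orP[/eqP <- //|]; rewrite ltnS => l11.
by rewrite expnS; have := IH l11; rewrite !expnS !expn0; nia.
Qed.

(** [mangoldt_sqr_ge] is applied with B about N/(log N)^3: the small primes then cost O(N/log N),
    while ln B >= (1 - eps) ln N. The losses combine to (1 - eps)(1 - 2 eps) >= 1 - 3 eps. *)
Lemma mangoldt_sqr_asymp_ge (eps : R) : 0 < eps <= 2^-1 -> \forall N \near \oo,
  (1 - eps) * N%:R <= chebyshev_psi N ->
  (1 - 3 * eps) * (N%:R * ln N%:R) <= mangoldt_sqr N.
Proof.
move=> /andP[e0 e1]; near=> N => hpsi.
(* 18/eps gives 3 ln x <= eps ln N through ln x <= 2 sqrt x and x <= 3 ln N; 4/eps bounds the small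
   primes by eps N; 12 yields l >= 11. *)
have big : (18 / eps) ^+ 2 + 4 / eps + 12 <= ln N%:R by near: N; exact: near_ln_ge.
have ei : 0 < eps^-1 by rewrite invr_gt0.
have e2 : 0 < (18 / eps) ^+ 2 by rewrite exprn_gt0 // divr_gt0.
have N0 : (0 < N)%N by case: (N) big => //; rewrite ln0 //; lra.
have NR : 0 < N%:R :> R by rewrite ltr0n.
pose l := trunc_log 2 N.
have /andP[lN Nl] : (2 ^ l <= N < 2 ^ l.+1)%N by apply: trunc_log_bounds.
set x : R := l.+1%:R.
have x0 : 0 < x by rewrite ltr0n.
have ln2 : ln 2 <= 1 :> R by have := @le_ln1Dx R 1; rewrite [1 + 1](_ : _ = 2); [apply; lra|lra].
have ln2' : 2^-1 <= ln 2 :> R.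
  have := @le_ln1Dx R (- 2^-1); have -> : 1 + - 2^-1 = 2^-1 :> R by lra.
  rewrite lnV ?posrE //; lra.
have xN : ln N%:R <= x.
  apply: le_trans (_ : ln (2 ^+ l.+1) <= _).
    by rewrite ler_ln ?posrE ?exprn_gt0 // -natrX ler_nat ltnW.
  by rewrite lnXn // -[ln 2 *+ _]mulr_natl ler_piMr.
have Nx : x <= 2 * ln N%:R + 1.
  have : ln (2 ^+ l) <= ln N%:R :> R by rewrite ler_ln ?posrE ?exprn_gt0 // -natrX ler_nat.
  rewrite lnXn // -[ln 2 *+ _]mulr_natl => h.
  have : l%:R * 2^-1 <= l%:R * ln 2 :> R by rewrite ler_wpM2l.
  rewrite /x -[l.+1%:R]natr1; lra.
have l11 : (11 <= l)%N.
  rewrite -ltnS -(ltr_nat R) -/x; apply: lt_le_trans xN; lra.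
have cube : ((l.+1) ^ 3 <= N)%N := leq_trans (cube_le_exp2 l11) lN.
pose B := (N %/ l.+1 ^ 3).+1.
have BN : B%:R <= 2 * N%:R / x ^+ 3.
  have c0 : 0 < x ^+ 3 by rewrite exprn_gt0.
  rewrite ler_pdivlMr // /x -natrX -natrM -natrM ler_nat /B mulSn mul2n -addnn.
  by rewrite leq_add // leq_trunc_div.
have NB : N%:R / x ^+ 3 <= B%:R.
  rewrite ler_pdivrMr ?exprn_gt0 // /x -natrX -natrM ler_nat.
  by rewrite ltnW // ltn_ceil // expn_gt0.
have hB : (1 - eps) * ln N%:R <= ln B%:R.
  apply: le_trans (_ : ln (N%:R / x ^+ 3) <= _); last first.
    by rewrite ler_ln ?posrE ?divr_gt0 ?exprn_gt0 // ltr0n.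
  rewrite ln_div ?posrE ?exprn_gt0 // lnXn //.
  have := ln_le_sqrt x0; set s := Num.sqrt x => hs.
  have s0 : 0 < s by rewrite sqrtr_gt0.
  have sE : s ^+ 2 = x by rewrite sqr_sqrtr // ltW.
  have s18 : 18 / eps <= s.
    rewrite -(@ler_pXn2r _ 2) ?nnegrE ?divr_ge0 ?(ltW e0) ?(ltW s0) // sE.
    apply: le_trans xN; apply: le_trans big; lra.
  have s18' : 18 <= eps * s by rewrite mulrC -ler_pdivrMr.
  have : 18 * s <= eps * x by rewrite -sE expr2 mulrA ler_wpM2r // ltW.
  have : eps * x <= eps * (3 * ln N%:R) by rewrite ler_wpM2l ?(ltW e0) //; clear -Nx big e2 ei; lra.
  rewrite [_ *+ 3]mulrS mulr2n; clear -hs; lra.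
have lN0 : 0 < ln N%:R :> R by lra.
have hC : ln N%:R * (B * l)%:R <= eps * N%:R.
  apply: le_trans (_ : x * (2 * N%:R / x ^+ 3 * x) <= _).
    rewrite ler_pM // ?(ltW lN0) // natrM ler_pM // /x ler_nat //.
  have -> : x * (2 * N%:R / x ^+ 3 * x) = 2 / x * N%:R by field; rewrite gt_eqF.
  rewrite ler_wpM2r // ler_pdivrMr //.
  apply: le_trans (_ : eps * ln N%:R <= _); last by rewrite ler_wpM2l // ltW.
  rewrite mulrC -ler_pdivrMr //; lra.
apply: le_trans (mangoldt_sqr_ge (isT : (0 < B)%N) Nl).
have h1 : (1 - 2 * eps) * N%:R <= chebyshev_psi N - ln N%:R * (B * l)%:R by lra.
have lB : 0 <= ln B%:R :> R by rewrite ln_ge0 // ler1n.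
apply: le_trans (ler_wpM2l lB h1).
apply: le_trans (_ : (1 - eps) * ln N%:R * ((1 - 2 * eps) * N%:R) <= _).
  have : 0 <= N%:R * ln N%:R :> R by rewrite mulr_ge0 // ltW.
  nra.
by rewrite ler_wpM2r // mulr_ge0 //; lra.
Unshelve. all: by end_near. Qed.

Lemma chebyshev_psi_sqr N : chebyshev_psi N ^+ 2 =
  mangoldt_sqr N + 2 * \sum_(1 <= k < N.+1) psi2 R N k%:Z.
Proof.
have := @normc_sqrE R N 0; rewrite mangoldt_expsumE /Normc.normc sqr_sqrtr; last by rewrite addr_ge0 // sqr_ge0.
under eq_bigr do rewrite mulr0 mulr0 cos0 mulr1.
under [X in _ + X ^+ 2 = _]eq_bigr do rewrite mulr0 mulr0 sin0 mulr0.
rewrite big1_eq expr0n addr0 -/(chebyshev_psi N) => ->; congr (_ + 2 * _).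
by apply: eq_bigr => k _; rewrite /tcos mulr0 mulr0 cos0 mulr1.
Qed.

(* Evaluating the pair correlations at frequency zero: a bound on [E] implies the
   prime number theorem. *)
Lemma chebyshev_psi_asymp (K eps : R) : 0 < K -> 0 < eps -> \forall N \near \oo,
  E R N <= K * (N%:R * ln N%:R) ^+ 2 -> `|chebyshev_psi N - N%:R| <= eps * N%:R.
Proof.
move=> K0 e0; have [B B0 HB] := @sum_singular_series R.
near=> N => hE.
have N2 : (2 <= N)%N by near: N; exists 2%N.
have NR : 2 <= N%:R :> R by rewrite ler_nat.
(* With q = N^(1/4) and t = ln N <= 4 q, the errors divided by N are t^2 <= 16 q^3, 2 (t + B) <= (8
   + 2 B) q^3 and (K + 1) sqrt(N) t <= 4 (K + 1) q^3; the coefficients add up to [C]. *)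
pose C := 28 + 2 * B + 4 * K.
have Nbig : (C / eps) ^+ 4 <= N%:R by near: N; exact: near_nat_ge.
set t : R := ln N%:R in hE *.
pose s : R := Num.sqrt N%:R; pose q : R := Num.sqrt s.
have sE : s ^+ 2 = N%:R by rewrite sqr_sqrtr //; lra.
have s0 : 0 <= s by exact: sqrtr_ge0.
have s1 : 1 <= s by rewrite -sqrtr1 ler_sqrt //; lra.
have qE : q ^+ 2 = s by rewrite sqr_sqrtr.
have q1 : 1 <= q by rewrite -sqrtr1 ler_sqrt.
have t4 : t <= 4 * q.
  rewrite /t -sE lnXn; last by lra.
  by have := @ln_le_sqrt s; rewrite -/q mulr2n; lra.
have t0 : 0 < t by apply: ln_gt0; lra.
have C0 : 0 < C by rewrite /C; lra.
have qC : C <= eps * q.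
  rewrite mulrC -ler_pdivrMr // -(@ler_pXn2r _ 4) ?nnegrE ?divr_ge0 ?(ltW C0) ?(ltW e0) //; last by lra.
  by rewrite -[q ^+ 4]/(q ^+ (2 * 2)) exprM qE sE.
pose err k : R := psi2 R N k%:Z - singular_series R k%:Z * (N%:R - k%:R).
(* Cauchy-Schwarz as 2 |err| <= err^2/(s t) + s t. The sum is O(N^(3/2) log N), small against N^2
   however large the fixed [K] is. *)
have herr : `|\sum_(1 <= k < N.+1) err k| <= 2^-1 * (K + 1) * (N%:R * (s * t)).
  apply: le_trans (ler_norm_sum _ _ _) _.
  apply: le_trans (_ : \sum_(1 <= k < N.+1) 2^-1 * ((s * t)^-1 * err k ^+ 2 + s * t) <= _).
    apply: ler_sum => k _; have st : 0 < s * t by rewrite mulr_gt0 //; lra.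
    rewrite -[err k ^+ 2]real_normK ?num_real // -subr_ge0.
    have -> : 2^-1 * ((s * t)^-1 * `|err k| ^+ 2 + s * t) - `|err k| =
      (`|err k| - s * t) ^+ 2 / (2 * (s * t)) by field; apply/andP; split; rewrite gt_eqF //; lra.
    by rewrite divr_ge0 ?sqr_ge0 // mulr_ge0 // ltW.
  rewrite -mulr_sumr big_split /= -mulr_sumr sumr_const_nat subn1 /= -[_ *+ N]mulr_natl -mulrA.
  rewrite ler_wpM2l // mulrDl mul1r lerD2r.
  have hE' : \sum_(1 <= k < N.+1) err k ^+ 2 <= K * (N%:R * t) ^+ 2.
    apply: le_trans hE; apply: ler_sum => k _; rewrite /= lerDl sqr_ge0 //.
  rewrite mulrC ler_pdivrMr; last by rewrite mulr_gt0 //; lra.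
  apply: le_trans hE' _; rewrite le_eqVlt; apply/orP; left; apply/eqP.
  by rewrite -sE; ring.
have hV : mangoldt_sqr N <= N%:R * t ^+ 2.
  apply: le_trans (mangoldt_sqr_le N) _; rewrite -/t.
  by have := chebyshev_psi_le N; rewrite -/t => /(ler_wpM2l (ltW t0)); lra.
have V0 : 0 <= (mangoldt_sqr N : R) by apply: sumr_ge0 => n _; exact: sqr_ge0.
have hS := HB N N2; rewrite -/t in hS.
have psiE : chebyshev_psi N ^+ 2 - N%:R ^+ 2 = mangoldt_sqr N +
   2 * (\sum_(1 <= k < N.+1) singular_series R k%:Z * (N%:R - k%:R) - N%:R ^+ 2 / 2) +
   2 * \sum_(1 <= k < N.+1) err k.
  rewrite chebyshev_psi_sqr (_ : \sum_(1 <= k < N.+1) psi2 R N k =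
     \sum_(1 <= k < N.+1) singular_series R k%:Z * (N%:R - k%:R) + \sum_(1 <= k < N.+1) err k).
    by field.
  by rewrite -big_split /=; apply: eq_bigr => k _; rewrite /err addrC subrK.
have h2 : `|chebyshev_psi N ^+ 2 - N%:R ^+ 2| <= eps * N%:R ^+ 2.
  rewrite psiE; apply: le_trans (ler_normD _ _) _; apply: le_trans (lerD (ler_normD _ _) (lexx _)) _.
  rewrite !normrM (ger0_norm V0) (@ger0_norm R 2) //.
  apply: le_trans (_ : N%:R * t ^+ 2 + 2 * (N%:R * (t + B)) + (K + 1) * (N%:R * (s * t)) <= _); first by clear -hV herr hS; lra.
  have -> : N%:R * t ^+ 2 + 2 * (N%:R * (t + B)) + (K + 1) * (N%:R * (s * t)) =
    N%:R * (t ^+ 2 + 2 * (t + B) + (K + 1) * (s * t)) by ring.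
  rewrite [N%:R ^+ 2]expr2 [eps * _]mulrCA ler_wpM2l //.
  have -> : N%:R = q ^+ 4 by rewrite -[q ^+ 4]/(q ^+ (2 * 2)) exprM qE sE.
  apply: le_trans (_ : C * q ^+ 3 <= _); last first.
    by rewrite [q ^+ 4]exprS [eps * _]mulrA ler_wpM2r ?exprn_ge0 //; clear -qC q1; lra.
  rewrite -qE.
  have t2 : t ^+ 2 <= 16 * q ^+ 2.
    rewrite (_ : 16 * q ^+ 2 = (4 * q) ^+ 2); last by ring.
    by rewrite ler_pXn2r ?nnegrE //; clear -t0 t4 q1; lra.
  have q2 : q ^+ 2 <= q ^+ 3 by rewrite [q ^+ 3]exprS ler_peMl ?sqr_ge0.
  have q3 : q <= q ^+ 3 by rewrite [q ^+ 3]exprS ler_peMr ?exprn_ege1 //; clear -q1; lra.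
  have q30 : 1 <= q ^+ 3 by rewrite exprn_ege1.
  have k1 : (K + 1) * (q ^+ 2 * t) <= (K + 1) * (4 * q ^+ 3).
    apply: ler_wpM2l; first by clear -K0; lra.
    rewrite (_ : 4 * q ^+ 3 = q ^+ 2 * (4 * q)); last by ring.
    by rewrite ler_wpM2l ?sqr_ge0.
  have k2 : B <= B * q ^+ 3 by rewrite ler_peMr.
  rewrite /C; clear -t2 q2 t4 q3 q30 k1 k2 B0; lra.
have psi0 : 0 <= chebyshev_psi N by apply: sumr_ge0 => n _; exact: von_mangoldt_ge0.
have pN : 0 < chebyshev_psi N + N%:R by clear -psi0 NR; lra.
move: h2; rewrite subr_sqr normrM (gtr0_norm pN) => h2.
have : `|chebyshev_psi N - N%:R| * N%:R <= eps * N%:R ^+ 2.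
  by apply: le_trans h2; rewrite ler_wpM2l //; clear -psi0; lra.
by rewrite expr2 mulrA ler_pM2r //; clear -NR; lra.
Unshelve. all: by end_near. Qed.

End Chebyshev.

(** * Asymptotics *)

Section Asymptotics.
Context {R : realType}.
Implicit Types (m N D : nat).

Definition isqrt N : nat := Num.truncn (Num.sqrt (N%:R : R)).

Lemma isqrt_bounds N : (0 < N)%N -> [/\ (0 < isqrt N <= N)%N,
  (isqrt N)%:R ^+ 2 <= N%:R :> R, N%:R / (isqrt N)%:R ^+ 2 <= 4 :> R &
  ln (N%:R : R) / 2 - 1 <= ln ((isqrt N)%:R : R) <= ln (N%:R : R) / 2].
Proof.
move=> N0; have NR : 1 <= N%:R :> R by rewrite ler1n.
rewrite /isqrt; set s := Num.sqrt (N%:R : R); set D := Num.truncn s.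
have sE : s ^+ 2 = N%:R by rewrite sqr_sqrtr.
have s1 : 1 <= s by rewrite -sqrtr1 ler_sqrt //; lra.
have s0 : 0 <= s by lra.
have /andP[Ds sD] : D%:R <= s < D.+1%:R := truncn_itv s0.
have D0 : (0 < D)%N by rewrite truncn_ge_nat.
have DR : 1 <= D%:R :> R by rewrite ler1n.
have s2D : s <= 2 * D%:R by move: sD; rewrite -natr1; lra.
have D2N : D%:R ^+ 2 <= N%:R :> R by rewrite -sE; nra.
split => //.
- rewrite D0 /= -(ler_nat R); apply: le_trans D2N.
  by rewrite expr2 ler_peMl.
- rewrite ler_pdivrMr ?exprn_gt0 //; last by lra.
  by rewrite -sE; nra.
have lN : ln N%:R = 2 * ln s.
  by rewrite -sE lnXn ?(lt_le_trans ltr01) // mulr2n; lra.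
have ln2 : ln 2 <= 1 :> R by have := @le_ln1Dx R 1; rewrite [1 + 1](_ : _ = 2); [apply; lra|lra].
have h1 : ln D%:R <= ln s by rewrite ler_ln ?posrE //; lra.
have h2 : ln s <= ln 2 + ln D%:R.
  by rewrite -lnM ?posrE; [rewrite ler_ln ?posrE //; lra|lra|lra].
by rewrite lN; apply/andP; split; lra.
Qed.

Definition nlogn N : R := N%:R * ln N%:R.

Lemma level_asymp (K eps : R) : 0 < K -> 0 < eps <= 1 -> \forall N \near \oo,
  E R N <= K * nlogn N ^+ 2 ->
  `|level N (isqrt N) - nlogn N / 2| <= eps * nlogn N /\
  mangoldt_sqr N <= (1 + eps) * nlogn N.
Proof.
move=> K0 /andP[eps0 eps1]; pose e := eps / 8.
have e0 : 0 < e by rewrite /e; lra.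
have [B B0 HB] := @C2_sum_hfac R e e0.
near=> N => hE.
have t1 : (1 + B) / e + 1 <= ln N%:R by near: N; exact: near_ln_ge.
have hpsi : `|chebyshev_psi N - N%:R| <= e * N%:R.
  by move: hE; near: N; exact: chebyshev_psi_asymp.
have hV : (1 - e) * N%:R <= chebyshev_psi N -> (1 - 3 * e) * nlogn N <= mangoldt_sqr N.
  by near: N; apply: mangoldt_sqr_asymp_ge; rewrite e0 /e; lra.
have N0 : (0 < N)%N by near: N; exists 1%N.
have NR : 0 < N%:R :> R by rewrite ltr0n.
have Be : 0 <= (1 + B) / e by rewrite divr_ge0 // ?(ltW e0) //; lra.
have [_ _ _ /andP[l1 l2]] := isqrt_bounds N0.
move: hpsi; rewrite ler_norml => /andP[p1 p2].
have {}hV : (1 - 3 * e) * nlogn N <= mangoldt_sqr N by apply: hV; clear -p1; lra.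
have hV2 : mangoldt_sqr N <= (1 + e) * nlogn N.
  apply: le_trans (mangoldt_sqr_le N) _; rewrite /nlogn mulrA [X in _ <= X]mulrC.
  by apply: ler_wpM2l; [clear -Be t1; lra|clear -p2; lra].
have := HB (isqrt N); rewrite ler_norml => /andP[a1 a2].
have S0 : 0 <= nlogn N by rewrite mulr_ge0 //; clear -Be t1; lra.
rewrite /level; set A := 2 * C2 R * _ in a1 a2 *.
set t := ln N%:R in t1 l1 l2 S0 *.
have BS : (1 + B) * N%:R <= e * nlogn N.
  rewrite /nlogn -/t mulrCA mulrC ler_wpM2l // mulrC -ler_pdivrMr //; clear -t1; lra.
have ld0 : 0 <= ln (isqrt N)%:R :> R.
  by have [/andP[h _] _ _ _] := isqrt_bounds N0; rewrite ln_ge0 // ler1n.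
have el : e * ln (isqrt N)%:R <= e * (t / 2) by apply: ler_wpM2l => //; exact: ltW.
have A1 : t / 2 - e * (t / 2) - 1 - B <= A by clear -a1 l1 el; lra.
have A2 : A <= t / 2 + e * (t / 2) + B by clear -a2 l2 el; lra.
have AN1 := ler_wpM2r (ltW NR) A1; have AN2 := ler_wpM2r (ltW NR) A2.
have SE : nlogn N = t * N%:R by rewrite /nlogn mulrC.
have eS : 0 <= e * nlogn N by rewrite mulr_ge0 // ltW.
have e8 : eps * nlogn N = 8 * (e * nlogn N) by rewrite /e; field.
rewrite ler_norml; split; last by clear -hV2 e8 eS; lra.
have BN : 0 <= B * N%:R by rewrite mulr_ge0 // ltW.
move: AN1 AN2 hV hV2 e8 BS eS; rewrite SE; clear -BN NR => AN1 AN2 hV hV2 e8 BS eS.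
by apply/andP; split; lra.
Unshelve. all: by end_near. Qed.

(** At this cut N/D^2 <= 4, so the discarded terms contribute O(N^2 log N), a logarithm less than
    [nlogn N ^+ 2]. *)
Lemma residual_asymp (eta : R) : 0 < eta -> \forall N \near \oo,
  2 * \sum_(1 <= k < N.+1) residual N (isqrt N) k ^+ 2 <= 4 * E R N + eta * nlogn N ^+ 2.
Proof.
move=> eta0; pose c : R := 64 * expR 96 ^+ 3.
near=> N; have t1 : 8 * c / eta + 1 <= ln N%:R by near: N; exact: near_ln_ge.
have N0 : (0 < N)%N by near: N; exists 1%N.
have [DN _ h4 _] := isqrt_bounds N0.
apply: le_trans (@residual_sqr_le R N (isqrt N) DN) _; rewrite lerD2l -/c.
have c0 : 0 <= c by rewrite mulr_ge0 // exprn_ge0 // expR_ge0.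
have ce : 0 <= 8 * c / eta by rewrite divr_ge0 ?(ltW eta0) // mulr_ge0.
rewrite /nlogn exprMn; set t := ln N%:R in t1 *.
apply: le_trans (_ : c * N%:R ^+ 2 * 4 * (2 * t) <= _).
  have cN : 0 <= c * N%:R ^+ 2 by rewrite mulr_ge0 ?sqr_ge0.
  rewrite ler_pM //; [|lra| |lra].
    by rewrite mulr_ge0 // divr_ge0 ?sqr_ge0.
  by rewrite ler_wpM2l.
have -> : c * N%:R ^+ 2 * 4 * (2 * t) = N%:R ^+ 2 * (8 * c * t) by ring.
rewrite [eta * _]mulrCA ler_wpM2l ?sqr_ge0 // [t ^+ 2]expr2 [eta * _]mulrA ler_wpM2r //; first by lra.
rewrite [eta * _]mulrC -ler_pdivrMr //; lra.
Unshelve. all: by end_near. Qed.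

(** [L1_norm_ge] with Lam = (1/2 + kappa) N log N. Then Lam - y is at least (kappa/2) N log N, and
    the mean square of W, at most (4K + eta)(N log N)^2, costs at most theta N log N. *)
Lemma L1_norm_asymp_ge (K kappa eta theta : R) :
  0 < K -> 0 < kappa -> 0 < eta <= 1 -> 2 * eta <= kappa ->
  4 * K + eta <= 2 * kappa * theta ->
  \forall N \near \oo, E R N <= K * nlogn N ^+ 2 ->
  (2^-1 - eta - theta) * Num.sqrt (nlogn N) <= Num.sqrt (2^-1 + kappa) * L1_norm R N.
Proof.
move=> K0 k0 eta01 etak thk; have /andP[eta0 _] := eta01; near=> N => hE.
have [hl hV] : `|level N (isqrt N) - nlogn N / 2| <= eta * nlogn N /\
  mangoldt_sqr N <= (1 + eta) * nlogn N by move: hE; near: N; exact: level_asymp.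
have hR : 2 * \sum_(1 <= k < N.+1) residual N (isqrt N) k ^+ 2 <= 4 * E R N + eta * nlogn N ^+ 2.
  by near: N; exact: residual_asymp.
have t1 : 1 <= ln N%:R :> R by near: N; exact: near_ln_ge.
have N0 : (0 < N)%N by near: N; exists 1%N.
have S0 : 0 < nlogn N by rewrite mulr_gt0 ?ltr0n //; lra.
move: hl; rewrite ler_norml => /andP[y1 y2].
set S := nlogn N in hE hV hR S0 y1 y2 *; set y := level _ _ in y1 y2.
set r := Num.sqrt S; have r0 : 0 < r by rewrite sqrtr_gt0.
have rE : r ^+ 2 = S by rewrite sqr_sqrtr // ltW.
have k20 : 0 < 2^-1 + kappa by lra.
have L0 : 0 < (2^-1 + kappa) * S by rewrite mulr_gt0.
have etaS : 2 * (eta * S) <= kappa * S by rewrite mulrA ler_wpM2r // ltW.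
have kS : 0 < kappa * S by rewrite mulr_gt0.
have yL : kappa * S / 2 <= (2^-1 + kappa) * S - y by clear -y2 etaS; lra.
have yL' : y < (2^-1 + kappa) * S by clear -yL kS; lra.
have := L1_norm_ge L0 yL'; rewrite -/y; set I := 2 * _ in hR *.
set a := (2^-1 + kappa) * S - y in yL *.
rewrite sqrtrM ?(ltW k20) // -/r => h.
have I0 : 0 <= I by rewrite mulr_ge0 //; apply: sumr_ge0 => k _; exact: sqr_ge0.
have hI : I / (4 * a) <= theta * S.
  rewrite ler_pdivrMr; last by clear -yL kS; lra.
  have hI1 : I <= (4 * K + eta) * S ^+ 2 by clear -hE hR; lra.
  have hI2 : (4 * K + eta) * S ^+ 2 <= 2 * kappa * theta * S ^+ 2.
    by rewrite ler_wpM2r ?sqr_ge0.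
  have th0 : 0 <= theta.
    rewrite leNgt; apply/negP => th; have : kappa * theta < 0 by rewrite pmulr_rlt0.
    lra.
  have tS : 0 <= theta * S by rewrite mulr_ge0 // ltW.
  have : theta * S * (kappa * S / 2) <= theta * S * a by rewrite ler_wpM2l.
  have -> : theta * S * (kappa * S / 2) = kappa * theta * S ^+ 2 / 2 by ring.
  clear -hI1 hI2; lra.
have : (2^-1 - eta - theta) * r * r <= Num.sqrt (2^-1 + kappa) * L1_norm R N * r.
  rewrite -mulrA -expr2 rE [X in _ <= X]mulrAC; clear -h hI y1; lra.
by rewrite ler_pM2r.
Unshelve. all: by end_near. Qed.

Lemma L1_norm_gg (K : R) : 0 < K -> exists2 c : R, 0 < c &
  \forall N \near \oo, E R N <= K * nlogn N ^+ 2 -> c * Num.sqrt (nlogn N) <= L1_norm R N.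
Proof.
(* [K] may be large, so the truncation level is raised with it: kappa = 20K + 1 admits theta = 1/8,
   since 4K + eta <= 5K. *)
move=> K0; pose eta : R := K / (8 * (K + 1)); pose kappa : R := 20 * K + 1.
have K1 : 0 < 8 * (K + 1) by rewrite mulr_gt0 //; lra.
have eta0 : 0 < eta by rewrite divr_gt0.
have eta1 : eta <= 8^-1 by rewrite /eta ler_pdivrMr //; lra.
have etaK : eta <= K by rewrite /eta ler_pdivrMr // ler_peMr //; lra.
have k0 : 0 < 2^-1 + kappa by rewrite /kappa; lra.
have s0 : 0 < Num.sqrt (2^-1 + kappa) by rewrite sqrtr_gt0.
exists (4^-1 / Num.sqrt (2^-1 + kappa)); first by rewrite divr_gt0.
near=> N => hE.
have : (2^-1 - eta - 8^-1) * Num.sqrt (nlogn N) <= Num.sqrt (2^-1 + kappa) * L1_norm R N.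
  move: hE; near: N; apply: L1_norm_asymp_ge => //; rewrite /kappa ?eta0 /=; lra.
have : 0 <= Num.sqrt (nlogn N) by exact: sqrtr_ge0.
rewrite mulrAC ler_pdivrMr // [L1_norm R N * _]mulrC => h; apply: le_trans.
by rewrite ler_wpM2r //; clear -eta1; lra.
Unshelve. all: by end_near. Qed.

Lemma L1_norm_asymp_lower (c : R) : 0 < c -> c ^+ 2 < 2^-1 ->
  exists K c' : R, [/\ 0 < K, c < c' &
  \forall N \near \oo, E R N <= K * nlogn N ^+ 2 -> c' * Num.sqrt (nlogn N) <= L1_norm R N].
Proof.
(* [g] is the gap between c^2 and 1/2. With eta = K and theta = g/16, this [K] makes 4K + eta = 2
   kappa theta exact, and all losses stay below the gap. *)
move=> c0 c2; pose g := 2^-1 - c ^+ 2; pose kappa := g / 8; pose K := kappa * g / 40.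
have g0 : 0 < g by rewrite /g; lra.
have g1 : g <= 2^-1 by rewrite /g; have := sqr_ge0 c; lra.
have k0 : 0 < kappa by rewrite /kappa; lra.
have K0 : 0 < K by rewrite /K divr_gt0 // mulr_gt0.
have Kg : K <= g / 16 by rewrite /K /kappa; nra.
have K2 : 2 * K <= kappa by rewrite /K; nra.
have kk : 0 < 2^-1 + kappa by lra.
have s0 : 0 < Num.sqrt (2^-1 + kappa) by rewrite sqrtr_gt0.
have q0 : 0 <= c ^+ 2 + g / 4 by have := sqr_ge0 c; lra.
exists K, (Num.sqrt (c ^+ 2 + g / 4)); split => //.
  rewrite -[X in X < _](@ger0_norm _ c) ?(ltW c0) // -sqrtr_sqr ltr_sqrt ?ltrDl; [lra|move: (sqr_ge0 c); lra].
near=> N => hE.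
have h : (2^-1 - K - g / 16) * Num.sqrt (nlogn N) <= Num.sqrt (2^-1 + kappa) * L1_norm R N.
  move: hE; near: N; apply: L1_norm_asymp_ge => //; first by rewrite K0 /=; lra.
  by rewrite /K; lra.
rewrite -(ler_pM2l s0); apply: le_trans h.
rewrite mulrA ler_wpM2r ?sqrtr_ge0 // -sqrtrM ?(ltW kk) //.
have b0 : 0 <= 2^-1 - K - g / 16 by clear -Kg g1; lra.
rewrite -[X in _ <= X](ger0_norm b0) -sqrtr_sqr ler_sqrt ?sqr_ge0 //.
have -> : c ^+ 2 = 2^-1 - g by rewrite /g subKr.
apply: le_trans (_ : (2^-1 - g / 8) ^+ 2 <= _); first by rewrite /kappa; clear -g0 g1; nra.
by rewrite ler_pXn2r ?nnegrE //; clear -Kg g0 g1; lra.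
Unshelve. all: by end_near. Qed.

Lemma L1_norm_asymp_upper (theta : R) : 0 < theta <= 4^-1 ->
  exists2 K : R, 0 < K & \forall N \near \oo, E R N <= K * nlogn N ^+ 2 ->
  L1_norm R N <= ((Num.sqrt 2)^-1 + 6 * theta) * Num.sqrt (nlogn N).
Proof.
move=> /andP[th0 th1]; pose K := theta ^+ 2 / 8.
have th20 : 0 < theta ^+ 2 by rewrite exprn_gt0.
have K0 : 0 < K by rewrite /K divr_gt0.
exists K => //; pose m := (Num.bound (theta ^+ 2)^-1).+1.
have mth : (theta ^+ 2)^-1 <= m%:R.
  apply: le_trans (ltW (archi_boundP _)) _; first by rewrite invr_ge0 ltW.
  by rewrite ler_nat.
near=> N => hE.
have [hl hV] : `|level N (isqrt N) - nlogn N / 2| <= theta * nlogn N /\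
  mangoldt_sqr N <= (1 + theta) * nlogn N.
  by move: hE; near: N; apply: level_asymp => //; rewrite th0 /=; lra.
have hR : 2 * \sum_(1 <= k < N.+1) residual N (isqrt N) k ^+ 2 <=
    4 * E R N + theta ^+ 2 / 2 * nlogn N ^+ 2.
  by near: N; apply: residual_asymp; rewrite divr_gt0.
pose c : R := 40 * expR 96.
have t1 : c * m%:R / theta + 1 <= ln N%:R :> R by near: N; exact: near_ln_ge.
have N0 : (0 < N)%N by near: N; exists 1%N.
have c0 : 0 <= c by rewrite mulr_ge0 // expR_ge0.
have cm0 : 0 <= c * m%:R / theta by rewrite divr_ge0 ?(ltW th0) // mulr_ge0.
have NR : 0 < N%:R :> R by rewrite ltr0n.
have S0 : 0 < nlogn N by rewrite mulr_gt0 //; clear -cm0 t1; lra.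
have [/andP[D0 _] D2N _ _] := isqrt_bounds N0.
move: hl; rewrite ler_norml => /andP[y1 y2].
have cN : c * (isqrt N * m)%:R * (isqrt N)%:R <= theta * nlogn N.
  apply: le_trans (_ : c * m%:R * N%:R <= _).
    rewrite natrM (_ : c * ((isqrt N)%:R * m%:R) * (isqrt N)%:R = c * m%:R * (isqrt N)%:R ^+ 2); last by ring.
    by rewrite ler_wpM2l // mulr_ge0.
  rewrite /nlogn [N%:R * _]mulrC mulrA ler_wpM2r ?(ltW NR) // [theta * _]mulrC -ler_pdivrMr //; clear -t1; lra.
set S := nlogn N in hE hV hR S0 y1 y2 cN *.
set r := Num.sqrt S; have r0 : 0 < r by rewrite sqrtr_gt0.
have rE : r ^+ 2 = S by rewrite sqr_sqrtr // ltW.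
have thS : 0 < theta * S by rewrite mulr_gt0.
have thS4 : theta * S <= S / 4 by rewrite mulrC ler_pM2l.
have y0 : 0 < (level N (isqrt N) : R) by clear -y1 thS4 S0; lra.
have m0 : 0 < (theta * S)^-1 by rewrite invr_gt0.
have l0 : 0 < theta / r by rewrite divr_gt0.
have L0 : (0 < isqrt N * m)%N by rewrite muln_gt0 D0.
apply: le_trans (L1_norm_le D0 L0 y0 m0 l0) _.
rewrite -/c invrK; set I := 2 * \sum_(_ <= _ < _) _ in hR *.
have hI : (theta * S)^-1 * I <= theta * S.
  rewrite mulrC ler_pdivrMr //.
  have : I <= theta ^+ 2 * S ^+ 2 by rewrite /K in hE; clear -hE hR; lra.
  by move=> /le_trans; apply; rewrite le_eqVlt; apply/orP; left; apply/eqP; ring.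
set y := level _ _ in y0 y1 y2 *.
have ry : r / 2 <= Num.sqrt y.
  rewrite -[X in X <= _](@ger0_norm _ (r / 2)); last by rewrite divr_ge0 // ltW.
  rewrite -sqrtr_sqr ler_sqrt ?(ltW y0) // expr_div_n rE; clear -y1 thS4; lra.
have yle : Num.sqrt y <= ((Num.sqrt 2)^-1 + theta) * r.
  have w0 : 0 < (Num.sqrt 2)^-1 :> R by rewrite invr_gt0 sqrtr_gt0.
  have w2 : ((Num.sqrt 2)^-1) ^+ 2 = 2^-1 :> R by rewrite exprVn sqr_sqrtr.
  have w1 : 2^-1 <= (Num.sqrt 2)^-1 :> R.
    by rewrite -(@ler_pXn2r _ 2) ?nnegrE ?(ltW w0) // w2; clear; lra.
  have b0 : 0 <= ((Num.sqrt 2)^-1 + theta) * r by rewrite mulr_ge0 ?(ltW r0) // addr_ge0 // ltW.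
  rewrite -[X in _ <= X](ger0_norm b0) -sqrtr_sqr ler_sqrt ?sqr_ge0 // exprMn rE.
  apply: le_trans (_ : (2^-1 + theta) * S <= _); first by clear -y2; lra.
  rewrite ler_wpM2r ?(ltW S0) // sqrrD w2 mulr2n.
  have : theta * 2^-1 <= theta * (Num.sqrt 2)^-1 by rewrite ler_wpM2l // ltW.
  clear -th20; lra.
have h1 : (c * (isqrt N * m)%:R * (isqrt N)%:R + 2^-1 * ((theta * S)^-1 * I + theta * S)) /
    (2 * Num.sqrt y) <= 2 * theta * r.
  have sy0 : 0 < Num.sqrt y by rewrite sqrtr_gt0.
  rewrite ler_pdivrMr; last by rewrite mulr_gt0.
  apply: le_trans (_ : 2 * theta * r * r <= _); last first.
    rewrite ler_wpM2l //; first by rewrite !mulr_ge0 // ltW.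
    clear -ry; lra.
  rewrite -[_ * r * r]mulrA -expr2 rE; clear -cN hI; lra.
have h2 : 2^-1 * (theta / r * mangoldt_sqr N + (theta / r)^-1 *
    (2 * (isqrt N)%:R / (isqrt N * m)%:R)) <= 2 * theta * r.
  have k1 : theta / r * mangoldt_sqr N <= 2 * theta * r.
    apply: le_trans (_ : theta / r * (2 * S) <= _).
      rewrite ler_wpM2l ?(ltW l0) //; apply: le_trans hV _; rewrite ler_wpM2r ?(ltW S0) //; clear -th1; lra.
    by rewrite -rE le_eqVlt; apply/orP; left; apply/eqP; field; rewrite gt_eqF.
  have k2 : (theta / r)^-1 * (2 * (isqrt N)%:R / (isqrt N * m)%:R) <= 2 * theta * r.
    have DR : 0 < (isqrt N)%:R :> R by rewrite ltr0n.
    have mR : 0 < m%:R :> R by rewrite ltr0n.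
    have -> : (theta / r)^-1 * (2 * (isqrt N)%:R / (isqrt N * m)%:R) = 2 * r / theta * m%:R^-1.
      by rewrite natrM; field; rewrite !gt_eqF.
    apply: le_trans (_ : 2 * r / theta * theta ^+ 2 <= _).
      rewrite ler_wpM2l //; first by rewrite divr_ge0 ?(ltW th0) // mulr_ge0 // ltW.
      by rewrite invf_ple // posrE.
    by rewrite le_eqVlt; apply/orP; left; apply/eqP; field; rewrite gt_eqF.
  clear -k1 k2; lra.
apply: le_trans (lerD (lerD yle h1) h2) _.
have : 0 < theta * r by rewrite mulr_gt0.
by rewrite !mulrDl; clear; lra.
Unshelve. all: by end_near. Qed.

End Asymptotics.

Theorem theorem1 (R : realType) :
  [/\ (exists2 c : R, 0 < c &
         E R ~_\oo (fun N => c * (N%:R ^+ 2 * ln N%:R ^+ 2))) ->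
      vinogradov_gg (L1_norm R)
        (fun N => Num.sqrt N%:R * Num.sqrt (ln N%:R)),
      (exists2 c : R, 0 < c < (Num.sqrt 2)^-1 &
         L1_norm R ~_\oo
           (fun N => c * (Num.sqrt N%:R * Num.sqrt (ln N%:R)))) ->
      vinogradov_gg (E R) (fun N => N%:R ^+ 2 * ln N%:R ^+ 2) &
      E R =o_\oo (fun N => N%:R ^+ 2 * ln N%:R ^+ 2) ->
      L1_norm R ~_\oo
        (fun N => (Num.sqrt 2)^-1 * (Num.sqrt N%:R * Num.sqrt (ln N%:R)))].
Proof.
have nlognE N : N%:R ^+ 2 * ln N%:R ^+ 2 = nlogn N ^+ 2 :> R by rewrite exprMn.
have sqrtE N : Num.sqrt N%:R * Num.sqrt (ln N%:R) = Num.sqrt (nlogn N) :> R by rewrite sqrtrM.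
split.
(* The asymptotics enter with relative error 1, as E <= 2 c (N log N)^2. *)
- move=> [c c0 /eqaddoP hc].
  have [d d0 hd] := @L1_norm_gg R (2 * c) (mulr_gt0 (ltr0Sn _ _) c0).
  exists d => //; near=> N; rewrite sqrtE.
  have : `|(E R - (fun N => c * (N%:R ^+ 2 * ln N%:R ^+ 2))) N| <=
      1 * `|c * (N%:R ^+ 2 * ln N%:R ^+ 2)|.
    by near: N; exact: (hc 1 ltr01).
  have : E R N <= 2 * c * nlogn N ^+ 2 -> d * Num.sqrt (nlogn N) <= L1_norm R N by near: N.
  rewrite nlognE mul1r (@ger0_norm _ (c * nlogn N ^+ 2)); last first.
    by apply: mulr_ge0; [exact: ltW|exact: sqr_ge0].
  move=> + h; apply; move: h; rewrite !fctE nlognE ler_norml => /andP[_]; lra.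
- move=> [c /andP[c0 c1] /eqaddoP hc].
  have w0 : 0 < Num.sqrt 2 :> R by rewrite sqrtr_gt0.
  have c2 : c ^+ 2 < 2^-1.
    have <- : (Num.sqrt 2)^-1 ^+ 2 = 2^-1 :> R by rewrite exprVn sqr_sqrtr.
    by rewrite ltr_pXn2r ?nnegrE ?invr_ge0 ?(ltW w0) ?(ltW c0).
  have [K [c' [K0 cc' hK]]] := L1_norm_asymp_lower c0 c2.
  (* (1 + e) c is the midpoint of c and c', so a small E(N) at one large N would contradict the
     assumed asymptotics at that N. *)
  pose e := (c' - c) / (2 * c).
  have e0 : 0 < e by rewrite divr_gt0 ?mulr_gt0 // subr_gt0.
  exists K => //; near=> N; rewrite nlognE leNgt; apply/negP => hE.
  have t1 : 1 <= ln N%:R :> R by near: N; exact: near_ln_ge.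
  have N0 : (0 < N)%N by near: N; exists 1%N.
  have S0 : 0 < nlogn N :> R by rewrite mulr_gt0 ?ltr0n //; lra.
  have h1 : E R N <= K * nlogn N ^+ 2 -> c' * Num.sqrt (nlogn N) <= L1_norm R N by near: N.
  have : `|(L1_norm R - (fun N => c * (Num.sqrt N%:R * Num.sqrt (ln N%:R)))) N| <=
      e * `|c * (Num.sqrt N%:R * Num.sqrt (ln N%:R))|.
    by near: N; exact: (hc e e0).
  rewrite !fctE sqrtE; have {h1} := h1 (ltW hE).
  set r := Num.sqrt (nlogn N); have r0 : 0 < r by rewrite sqrtr_gt0.
  rewrite [`|c * r|]gtr0_norm ?mulr_gt0 // => h1; rewrite ler_norml => /andP[_ h2].
  have : e * (c * r) = (c' - c) / 2 * r by rewrite /e; field; rewrite gt_eqF.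
  have : 0 < (c' - c) * r by rewrite mulr_gt0 // subr_gt0.
  lra.
- move=> /eqoP ho; apply/eqaddoP => e e0.
  have w0 : 0 < (Num.sqrt 2)^-1 :> R by rewrite invr_gt0 sqrtr_gt0.
  set w := (Num.sqrt 2)^-1 in w0 *.
  have w2 : w ^+ 2 = 2^-1 :> R by rewrite exprVn sqr_sqrtr.
  (* The cap 1/2 keeps (1 - e') w positive when [e] is 1 or more. *)
  pose e' := Num.min e 2^-1.
  have e'0 : 0 < e' by rewrite lt_min e0 /=; lra.
  have e'1 : e' <= 2^-1 by rewrite ge_min lexx orbT.
  have e'e : e' <= e by rewrite ge_min lexx.
  have c0 : 0 < (1 - e') * w by rewrite mulr_gt0 //; lra.
  have c2 : ((1 - e') * w) ^+ 2 < 2^-1 by rewrite exprMn w2; nra.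
  have [K [c' [K0 cc' hK]]] := L1_norm_asymp_lower c0 c2.
  pose th := Num.min (e * w / 6) 4^-1.
  have th0 : 0 < th by rewrite lt_min divr_gt0 ?mulr_gt0 //=; lra.
  have [|K' K'0 hK'] := @L1_norm_asymp_upper R th.
    by rewrite th0 /= ge_min lexx orbT.
  near=> N; rewrite !fctE sqrtE.
  have hE : `|E R N| <= Num.min K K' * `|N%:R ^+ 2 * ln N%:R ^+ 2|.
    by near: N; apply: ho; rewrite lt_min K0.
  have h1 : E R N <= K * nlogn N ^+ 2 -> c' * Num.sqrt (nlogn N) <= L1_norm R N by near: N.
  have h2 : E R N <= K' * nlogn N ^+ 2 -> L1_norm R N <= (w + 6 * th) * Num.sqrt (nlogn N) by near: N.
  rewrite nlognE [X in _ * X]ger0_norm ?sqr_ge0 // in hE.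
  have {}hE := le_trans (ler_norm _) hE.
  have {}h1 : c' * Num.sqrt (nlogn N) <= L1_norm R N.
    by apply: h1; apply: le_trans hE _; rewrite ler_wpM2r ?sqr_ge0 // ge_min lexx.
  have {}h2 : L1_norm R N <= (w + 6 * th) * Num.sqrt (nlogn N).
    by apply: h2; apply: le_trans hE _; rewrite ler_wpM2r ?sqr_ge0 // ge_min lexx orbT.
  have r0 : 0 <= Num.sqrt (nlogn N) :> R by exact: sqrtr_ge0.
  set r := Num.sqrt (nlogn N) in h1 h2 r0 *.
  rewrite [`|w * r|]ger0_norm ?mulr_ge0 ?(ltW w0) //.
  have h3 : (w + 6 * th) * r <= (w + e * w) * r.
    rewrite ler_wpM2r // lerD2l.
    have : th <= e * w / 6 by rewrite ge_min lexx.
    clear; lra.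
  have h4 : (1 - e) * w * r <= c' * r.
    rewrite ler_wpM2r //; apply: le_trans (ltW cc'); rewrite ler_wpM2r ?(ltW w0) //; clear -e'e; lra.
  rewrite ler_norml; clear -h1 h2 h3 h4; apply/andP; split; lra.
Unshelve. all: by end_near.
Qed.
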